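(* There is no asymptotically correct discrimination procedure for the class of $B$-processes. That is, let $A=\{0,1\}$ and let $\mathcal{B}$ be the set of all $B$-processes with values in $A$. Then there does not exist a family of mappings $D_n: A^n\times A^n\to\{0,1\}$, $n\in\mathbb{N}$, such that for all $\rho_x,\rho_y\in\mathcal{B}$ (including the case $\rho_x=\rho_y$), when the sequences $x_1,x_2,\dots$ and $y_1,y_2,\dots$ are generated independently of each other by $\rho_x$ and $\rho_y$ respectively, the following limit exists and satisfies $$\lim_{n\to\infty}\mathbf{E}_{\rho_x\times\rho_y}\, D_n\big((x_1,\dots,x_n),(y_1,\dots,y_n)\big)=\begin{cases}0 & \text{if } \rho_x=\rho_y,\\ 1 & \text{otherwise.}\end{cases}$$
   Context: Let $A=\{0,1\}$. A process (process distribution) is a probability distribution on the set $A^\infty$ of one-way infinite sequences over $A$ (with the product $\sigma$-algebra); stationarity and ergodicity are with respect to the shift. A discrimination procedure $D$ is a family of mappings $D_n:A^n\times A^n\to\{0,1\}$, $n\in\mathbb{N}$. It is asymptotically correct for a set $\mathcal{C}$ of process distributions if for any two distributions $\rho_x,\rho_y\in\mathcal{C}$ (possibly equal) independently generating the sequences $x_1,x_2,\dots$ and $y_1,y_2,\dots$ respectively, the limit $\lim_{n\to\infty}\mathbf{E}D_n((x_1,\dots,x_n),(y_1,\dots,y_n))$ exists and equals $0$ if $\rho_x=\rho_y$ and $1$ otherwise. Here $\mathbf{E}=\mathbf{E}_{\rho_x\times\rho_y}$ is expectation with respect to the product measure $\rho_x\times\rho_y$. $\bar d$-distance: for two stationary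 processes $\rho_x$ and $\rho_y$ with values in $A$, $\bar d(\rho_x,\rho_y)$ is the infimum of all $\epsilon$ for which there exists a stationary process $\nu_{xy}$ on pairs $(x_n,y_n)$, $n\in\mathbb{N}$ (with values in $A\times A$), such that $(x_n)_{n\in\mathbb{N}}$ is distributed according to $\rho_x$, $(y_n)_{n\in\mathbb{N}}$ is distributed according to $\rho_y$, and $\nu_{xy}(x_1\neq y_1)\le\epsilon$. A stationary process is called a $B$-process (or Bernoulli process) if it is in the $\bar d$-closure of the set of all aperiodic stationary ergodic $k$-step Markov processes (with values in $A$), where $k$ ranges over $\mathbb{N}$. *)

(* Defs.v *)
From HB Require Import structures.
From mathcomp Require Import all_boot all_order all_algebra.
From mathcomp Require Import all_classical all_reals all_analysis.

Set Implicit Arguments.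
Unset Strict Implicit.
Unset Printing Implicit Defensive.

Import Order.TTheory GRing.Theory Num.Theory.
Import numFieldNormedType.Exports.

Local Open Scope classical_set_scope.
Local Open Scope ring_scope.

Section SequenceSpace.
Context {d : measure_display} (A : measurableType d).

Definition coordinate_sets : set (set (nat -> A)) :=
  \bigcup_(i in [set: nat])
    preimage_set_system [set: nat -> A] (fun x => x i) measurable.

(* One-way infinite sequences with the product sigma-algebra. Coordinates are
   numbered from 0, so the letter x_(i+1) of a sequence x is [x i]. *)
Definition path_space : Type := nat -> A.

HB.instance Definition _ := Pointed.on path_space.
HB.instance Definition _ :=
  Measurable.copy path_space (g_sigma_algebraType coordinate_sets).

End SequenceSpace.

Section Processes.
Context {d : measure_display} {A : measurableType d} {R : realType}.
Implicit Types P : probability (path_space A) R.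

Definition shift (x : path_space A) : path_space A := fun n => x n.+1.

Definition stationary P : Prop :=
  forall E : set (path_space A), measurable E -> P (shift @^-1` E) = P E.

Definition ergodic P : Prop :=
  forall E : set (path_space A), measurable E -> shift @^-1` E = E ->
    P E = 0%E \/ P E = 1%E.

Definition prefix_of (n : nat) (x : path_space A) : n.-tuple A :=
  [tuple x i | i < n].

(* The word [w] occurs in the sequence at positions m, ..., m + size w - 1. *)
Definition word_at (m : nat) (w : seq A) : set (path_space A) :=
  [set x | mkseq (fun i => x (m + i)%N) (size w) = w].

Definition cond_prob P (E F : set (path_space A)) : R :=
  fine (P (E `&` F)) / fine (P F).

(* The past [u ++ v] of positive probability, with [v] its last k letters,
   predicts the next letter exactly as [v] alone does. *)
Definition markov (k : nat) P : Prop :=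
  forall (u v : seq A) (a : A), size v = k ->
    (0 < P (word_at 0 (u ++ v)))%E ->
    cond_prob P (word_at (size (u ++ v)) [:: a]) (word_at 0 (u ++ v)) =
    cond_prob P (word_at (size (u ++ v)) [:: a]) (word_at (size u) v).

(* Aperiodicity of the chain of k-letter blocks of a stationary k-step Markov
   process: the return times of every block of positive probability have
   greatest common divisor 1. *)
Definition aperiodic (k : nat) P : Prop :=
  forall v : seq A, size v = k -> (0 < P (word_at 0 v))%E ->
    forall q : nat,
      (forall n : nat, (0 < n)%N ->
         (0 < P (word_at 0 v `&` word_at n v))%E -> (q %| n)%N) ->
      q = 1%N.

End Processes.

(* Measures are total functions on all subsets, with unconstrained values
   outside the sigma-algebra, so two distributions are equal when they agree on
   measurable sets; Leibniz equality would be too strong. *)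
Definition same_distribution {d : measure_display} {T : measurableType d}
    {R : realType} (mu nu : set T -> \bar R) : Prop :=
  forall E : set T, measurable E -> mu E = nu E.

Section BinaryProcesses.
Context {R : realType}.

Definition process : Type := probability (path_space bool) R.

Definition pair_process : Type := probability (path_space (bool * bool)%type) R.

Definition first_sequence (z : path_space (bool * bool)%type) :
  path_space bool := fun n => (z n).1.

Definition second_sequence (z : path_space (bool * bool)%type) :
  path_space bool := fun n => (z n).2.

Definition joining (Px Py : process) (nu : pair_process) : Prop :=
  [/\ stationary nu,
      same_distribution (pushforward nu first_sequence) Px &
      same_distribution (pushforward nu second_sequence) Py].

Definition dbar (Px Py : process) : \bar R :=
  ereal_inf [set eps%:E | eps in
    [set eps : R | exists nu : pair_process, joining Px Py nu /\
       (nu [set z : path_space (bool * bool)%type | (z 0%N).1 != (z 0%N).2]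
          <= eps%:E)%E]].

Definition aperiodic_ergodic_markov (P : process) : Prop :=
  [/\ stationary P, ergodic P &
      exists k : nat, [/\ (0 < k)%N, markov k P & aperiodic k P]].

Definition B_process : set process :=
  [set P | stationary P /\
     forall eps : R, 0 < eps ->
       exists Q : process, aperiodic_ergodic_markov Q /\
         (dbar P Q < eps%:E)%E].

Definition discrimination_procedure : Type :=
  forall n : nat, n.-tuple bool -> n.-tuple bool -> bool.

Definition expected_answer (D : discrimination_procedure) (Px Py : process)
    (n : nat) : \bar R :=
  'E_(Px \x Py)[fun xy : path_space bool * path_space bool =>
    (D n (prefix_of n xy.1) (prefix_of n xy.2))%:R]%E.

Definition asymptotically_correct (D : discrimination_procedure)
    (C : set process) : Prop :=
  forall Px Py : process, C Px -> C Py ->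
    (same_distribution Px Py ->
       expected_answer D Px Py n @[n --> \oo] --> 0%E) /\
    (~ same_distribution Px Py ->
       expected_answer D Px Py n @[n --> \oo] --> 1%E).

End BinaryProcesses.

Arguments process : clear implicits.
Arguments pair_process : clear implicits.
Arguments B_process : clear implicits.

(* Main.v *)
Require Import Defs.
From HB Require Import structures.
From mathcomp Require Import all_boot all_order all_algebra.
From mathcomp Require Import all_classical all_reals all_analysis.
From mathcomp Require Import measurable_realfun.
From mathcomp Require Import ring lra zify.

(** Why no discrimination procedure exists.

    Suppose that a procedure D is asymptotically correct.  The contradiction is
    a single B-process Q for which two independent samples are told apart with
    probability at least 1/128 at arbitrarily large times, although both have
    the same distribution.

    Q is made of infinitely many layers.  Layer t is visible at a random set of
    times of density about 2^-(c t), where it displays a state in {0,1} that is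
    drawn anew at rate 2^-(c (t+1)).  Freeze the state of layer t at 0 or at 1
    and hide the layers above t: this gives two different processes, which D
    separates at some time n.  Choose c (t+1) only now, so large that up to time
    n the state of layer t rarely changes and the layers above t are rarely
    visible.  Then Q gives every word of length n at least 1/8 of the probability
    that either frozen process gives it (frozen_le_limit).  So with probability
    of order 1/64 two independent samples of Q look like samples of the two
    different frozen processes, and D takes them for samples of different
    processes (pair_words_le).  This happens for every t.

    It remains to see that Q and the frozen processes are B-processes.  All of
    them are codings of one field of independent fair coins: the letter at time n
    is a fixed measurable function phi of the field shifted by n.  Every coding is
    stationary and inherits from the coins that it is mixing, hence ergodic and
    aperiodic; two codings of the same coins are joined by construction, so their
    d-bar distance is at most the probability that they disagree at time 0
    (dbar_factor_le).  And every coding is a B-process (factor_B).  Indeed phi is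
    close to a function of the coins in a time window of length m.  Insert
    markers, which are runs of M ones that occur nowhere else, separated by long
    stretches of data and an idle time of random length, and let the coding start
    afresh at each marker.  The phase of this cycle can be read off a bounded
    number of letters, and the data next to a marker are independent of the
    letters on its other side; so the modified process is Markov of finite order
    (marked_markov), and markers, idle time and the few suppressed data letters
    occupy a small fraction of the time (pr_not_live_le).  Since codings look
    forward in time, the cycle of marker, data and idle time runs backwards; the
    Markov property does not depend on the direction of time
    (markov_of_reversed). *)

Set Implicit Arguments.
Unset Strict Implicit.
Unset Printing Implicit Defensive.

Import Order.TTheory GRing.Theory Num.Theory.
Import numFieldNormedType.Exports.

Local Open Scope classical_set_scope.
Local Open Scope ring_scope.

(** * Probabilities as real numbers *)

Section real_probability.
Context d (T : measurableType d) (R : realType) (P : probability T R).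
Implicit Types A B : set T.

Definition pr A : R := fine (P A).

Lemma prE A : measurable A -> P A = (pr A)%:E.
Proof. by move=> mA; rewrite /pr fineK// fin_num_measure. Qed.

Lemma pr_ge0 A : 0 <= pr A.
Proof. exact: fine_ge0. Qed.

Lemma pr_setT : pr setT = 1.
Proof. by rewrite /pr probability_setT. Qed.

Lemma pr_set0 : pr set0 = 0.
Proof. by rewrite /pr measure0. Qed.

Lemma le_pr A B : measurable A -> measurable B -> A `<=` B -> pr A <= pr B.
Proof. by move=> mA mB AB; rewrite -lee_fin -!prE// le_measure ?inE. Qed.

Lemma pr_le1 A : measurable A -> pr A <= 1.
Proof. by move=> mA; rewrite -lee_fin -prE// probability_le1. Qed.

Lemma pr_gt0 A : measurable A -> (0 < P A)%E <-> 0 < pr A.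
Proof. by move=> mA; rewrite prE// lte_fin. Qed.

Lemma prU A B : measurable A -> measurable B -> A `&` B = set0 ->
  pr (A `|` B) = pr A + pr B.
Proof.
move=> mA mB AB; apply: EFin_inj; rewrite EFinD -!prE//; last exact: measurableU.
exact: measureU.
Qed.

Lemma prDI A B : measurable A -> measurable B ->
  pr A = pr (A `&` B) + pr (A `&` ~` B).
Proof.
move=> mA mB; rewrite -prU; first by rewrite -setIUr setUv setIT.
- exact: measurableI.
- by apply: measurableI => //; exact: measurableC.
- by rewrite setIACA setICr setI0.
Qed.

Lemma prC A : measurable A -> pr (~` A) = 1 - pr A.
Proof.
move=> mA; rewrite -pr_setT (prDI measurableT mA) !setTI; lra.
Qed.

Lemma prU_le A B : measurable A -> measurable B ->
  pr (A `|` B) <= pr A + pr B.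
Proof.
move=> mA mB; rewrite -lee_fin EFinD -!prE//; last exact: measurableU.
exact: measureU2.
Qed.

Lemma probability_setI_full A B : measurable A -> measurable B -> P B = 1%E ->
  P (A `&` B) = P A.
Proof.
move=> mA mB PB.
have PCB : P (~` B) = 0%E by rewrite probability_setC// PB subee.
rewrite (measureDI P mA mB) -[LHS]add0e; congr (_ + _)%E; apply/esym.
apply: (subset_measure0 _ _ _ PCB).
- exact: measurableD.
- exact: measurableC.
- by move=> x [].
Qed.

Lemma prI_full A B : measurable A -> measurable B -> pr B = 1 ->
  pr (A `&` B) = pr A.
Proof.
by move=> mA mB B1; rewrite /pr probability_setI_full// prE// B1.
Qed.

Lemma eq_pr_on A B G : measurable A -> measurable B -> measurable G ->
  pr G = 1 -> A `&` G = B `&` G -> pr A = pr B.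
Proof. by move=> mA mB mG G1 AB; rewrite -(prI_full mA mG)// AB prI_full. Qed.

Lemma pr_bigcup_ord_le n (A : nat -> set T) : (forall i, measurable (A i)) ->
  pr [set x | exists2 i, (i < n)%N & A i x] <= \sum_(i < n) pr (A i).
Proof.
move=> mA; have mU k : measurable [set x | exists2 i, (i < k)%N & A i x].
  rewrite (_ : [set _ | _] = \bigcup_(i in [set i | (i < k)%N]) A i).
    exact: bigcup_measurable.
  by apply/seteqP; split=> x /= [i ? ?]; exists i.
elim: n => [|n IHn].
  rewrite big_ord0 (_ : [set _ | _] = set0) ?pr_set0//.
  by apply/seteqP; split=> x //= [].
rewrite big_ord_recr/=; apply: le_trans (lerD IHn (lexx _)).
apply: le_trans (prU_le (mU _) (mA _)); apply: le_pr => //.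
  exact: measurableU.
move=> x /= [i]; rewrite ltnS leq_eqVlt => /predU1P[->|h] Ai; first by right.
by left; exists i.
Qed.

Lemma pr_bigcap_full (A : nat -> set T) : (forall i, measurable (A i)) ->
  (forall i, pr (A i) = 1) -> pr (\bigcap_i A i) = 1.
Proof.
move=> mA A1; have mI : measurable (\bigcap_i A i) by exact: bigcapT_measurable.
suff : P (~` \bigcap_i A i) = 0%E.
  by rewrite prE ?prC//; [move=> -[]; lra|exact: measurableC].
rewrite setC_bigcap.
have := @measure_sigma_subadditive _ _ _ P (\bigcup_i ~` A i) (fun i => ~` A i).
move=> h; apply/eqP; rewrite -measure_le0; apply: le_trans (h _ _ _) _ => //.
- by move=> i; exact: measurableC.
- by apply: bigcupT_measurable => i; exact: measurableC.
have C0 i : P (~` A i) = 0%E.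
  by rewrite prE ?prC ?A1 ?subrr//; exact: measurableC.
by rewrite eseries0// => i _ _; exact: C0.
Qed.

Lemma pr_nondecreasing_lim (F : nat -> set T) (e : R) : (forall i, measurable (F i)) ->
  nondecreasing_seq F -> 0 < e ->
  exists n, pr (\bigcup_i F i) - e < pr (F n).
Proof.
move=> mF ndF e0; have mU : measurable (\bigcup_i F i) by exact: bigcupT_measurable.
have : (fun n => P (F n)) @ \oo --> P (\bigcup_i F i).
  exact: (nondecreasing_cvg_mu (mu := P) mF mU ndF).
rewrite prE// => /fine_cvg.
have lt_e : pr (\bigcup_i F i) - e < pr (\bigcup_i F i) by lra.
by move=> /cvgr_gt /(_ _ lt_e) [n _ /(_ n (leqnn n)) h]; exists n.
Qed.

Lemma pr_bigcup_le (A : nat -> set T) (b : R) : (forall i, measurable (A i)) ->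
  (forall n, \sum_(i < n) pr (A i) <= b) -> pr (\bigcup_i A i) <= b.
Proof.
move=> mA sb; apply/ler_addgt0Pr => e e0.
pose F n := [set x | exists2 i, (i < n)%N & A i x].
have mF n : measurable (F n).
  rewrite (_ : F n = \bigcup_(i in [set i | (i < n)%N]) A i).
    exact: bigcup_measurable.
  by apply/seteqP; split=> x /= [i ? ?]; exists i.
have ndF : nondecreasing_seq F.
  by move=> n m nm; apply/subsetPset => x [i lin Ai]; exists i => //; exact: leq_trans nm.
have [n] := pr_nondecreasing_lim mF ndF e0.
rewrite (_ : \bigcup_i F i = \bigcup_i A i).
  have := pr_bigcup_ord_le n mA; have := sb n; rewrite -/(F n); lra.
apply/seteqP; split=> x [i _]; first by case=> j _ Aj; exists j.
by move=> Ai; exists i.+1 => //; exists i.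
Qed.

End real_probability.

(** * A field of fair coins from binary digits *)

(** A site consists of a time, a level and a slot; the levels and slots provide
    each time with countably many independent sources of randomness. *)
Definition site : Type := (nat * nat * nat)%type.
Definition field : Type := site -> bool.
Definition site_events : set (set field) :=
  [set [set w : field | w p] | p in [set: site]].

HB.instance Definition _ := Pointed.on field.
HB.instance Definition _ :=
  Measurable.copy field (g_sigma_algebraType site_events).

Lemma measurable_site p : measurable [set w : field | w p].
Proof. by apply: sub_sigma_algebra; exists p. Qed.

Lemma measurable_to_field d (T : measurableType d) (f : T -> field) :
  (forall p, measurable [set t | f t p]) -> measurable_fun setT f.
Proof.
move=> mf.
apply: (@measurability _ _ _ _ _ _ site_events) => //.
by move=> _ [_ [p _ <-] <-]; rewrite setTI; exact: mf.
Qed.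

Lemma measurable_boolP d (T : measurableType d) (f : T -> bool) :
  measurable [set t | f t] <-> measurable_fun setT f.
Proof.
split=> [mf|mf].
  apply: (@measurable_fun_bool _ _ _ _ true).
  by rewrite setTI (_ : _ @^-1` _ = [set t | f t]).
rewrite (_ : [set t | f t] = setT `&` f @^-1` [set true]); last by rewrite setTI.
exact: mf.
Qed.

Section digits.
Context {R : realType}.
Implicit Types (x l : R) (n : nat).

(** The binary digits of x are read off the orbit of x under the doubling map of
    [0, 1), which makes the points with prescribed first n digits an interval. *)
Definition doubling x : R := if x < 2^-1 then 2 * x else 2 * x - 1.
Definition digit n x : bool := 2^-1 <= iter n doubling x.

Lemma digitS n x : digit n.+1 x = digit n (doubling x).
Proof. by rewrite /digit iterSr. Qed.

Lemma doubling_itv x : 0 <= x < 1 -> 0 <= doubling x < 1.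
Proof.
by move=> /andP[h0 h1]; rewrite /doubling; case: ltP => h; apply/andP; split; lra.
Qed.

Lemma digit_interval n (f : nat -> bool) : exists l : R,
  [/\ 0 <= l, l + 2^-1 ^+ n <= 1 &
   forall x, 0 <= x < 1 ->
    (forall i, (i < n)%N -> digit i x = f i) <-> l <= x < l + 2^-1 ^+ n].
Proof.
elim: n f => [|n IHn] f.
  exists 0; rewrite expr0; split; [lra|lra|] => x xI; split => // _.
  by rewrite add0r.
have [l [l0 l1 lP]] := IHn (f \o S).
set e := 2^-1 ^+ n in l1 lP.
have e0 : 0 < e by rewrite exprn_gt0// invr_gt0.
exists ((l + (f 0%N)%:R) / 2); rewrite exprS -/e; split.
- by case: (f 0%N) => /=; lra.
- by case: (f 0%N) => /=; lra.
move=> x xI.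
have /lP dP := doubling_itv xI.
have -> : (forall i, (i < n.+1)%N -> digit i x = f i) <->
  digit 0 x = f 0%N /\ forall i, (i < n)%N -> digit i (doubling x) = (f \o S) i.
  split=> [h|[h0 h] [|i] //].
    split=> [|i ni]; first exact: h.
    by rewrite -digitS; exact: h.
  by rewrite digitS => /h.
rewrite dP /digit /= /doubling.
case: (f 0%N) => /=; case: ltP => hx; split.
- by move=> [? ?]; lra.
- by move=> ?; exfalso; lra.
- by move=> [? ?]; lra.
- by move=> ?; split => //; lra.
- by move=> [? ?]; lra.
- by move=> ?; split => //; lra.
- by move=> [].
- by move=> ?; exfalso; lra.
Qed.

Lemma measurable_doubling : measurable_fun setT doubling.
Proof.
rewrite /doubling; apply: measurable_fun_ifT.
- exact: measurable_fun_ltr.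
- exact: measurable_funM.
- by apply: measurable_funB => //; exact: measurable_funM.
Qed.

Lemma measurable_digit n : measurable [set x | digit n x].
Proof.
have mi : measurable_fun setT (iter n doubling).
  elim: n => [|n IHn]; first exact: measurable_id.
  exact: (measurableT_comp measurable_doubling IHn).
rewrite (_ : [set x | digit n x] = setT `&` iter n doubling @^-1` `[2^-1, +oo[).
  exact: mi.
by rewrite setTI; apply/seteqP; split=> x /=; rewrite /digit in_itv/= andbT.
Qed.

Definition unit_uniform : probability (measurableTypeR R) R := uniform_prob (@ltr01 R).

Lemma unit_uniform_itv (l e : R) : 0 <= l -> 0 <= e -> l + e <= 1 ->
  unit_uniform [set` `[l, l + e[] = e%:E.
Proof.
move=> l0 e0 le1; rewrite /unit_uniform /= /uniform_prob integral_uniform_pdf.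
rewrite setIidl; last by move=> x /=; rewrite !in_itv/= => /andP[? ?]; lra.
rewrite (eq_integral (fun=> 1%E)); last first.
  move=> x; rewrite inE/= /uniform_pdf in_itv/= => /andP[? ?].
  by rewrite ifT ?subr0 ?invr1//; lra.
rewrite integral_cst//= mul1e lebesgue_measure_itv/= lte_fin.
case: ltP => h; first by rewrite -EFinD; congr EFin; lra.
by congr EFin; lra.
Qed.

Lemma measurable_digit_eq (n : nat) (b : bool) : measurable [set x | digit n x = b].
Proof.
have /measurable_boolP h := measurable_digit n.
by have := h measurableT [set b] I; rewrite setTI.
Qed.

Lemma measurable_digits (s : seq nat) (f : nat -> bool) :
  measurable [set x : R | forall i, i \in s -> digit i x = f i].
Proof.
elim: s => [|j s IHs].
  by rewrite (_ : [set _ | _] = setT)//; apply/seteqP; split.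
rewrite (_ : [set _ | _] = [set x | digit j x = f j] `&`
   [set x : R | forall i, i \in s -> digit i x = f i]).
  by apply: measurableI => //; exact: measurable_digit_eq.
apply/seteqP; split=> x /= => [h|[hj h] i].
  by split=> [|i si]; apply: h; rewrite inE ?eqxx ?si ?orbT.
by rewrite inE => /predU1P[->|/h].
Qed.

Lemma uniform_digits_prefix n (f : nat -> bool) :
  unit_uniform [set x | forall i, (i < n)%N -> digit i x = f i] = (2^-1 ^+ n)%:E.
Proof.
have [l [l0 l1 lP]] := digit_interval n f.
have e0 : 0 <= (2^-1 : R) ^+ n by rewrite exprn_ge0// invr_ge0.
have I1 : unit_uniform [set` `[0, 1[] = 1%E.
  by have := @unit_uniform_itv 0 1; rewrite add0r; apply; lra.
have mE : measurable [set x : R | forall i, (i < n)%N -> digit i x = f i].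
  have := measurable_digits (iota 0 n) f.
  by congr measurable; apply/seteqP; split=> x /= h i hi; apply: h;
    move: hi; rewrite mem_iota.
rewrite -(unit_uniform_itv l0 e0 l1).
rewrite -(@probability_setI_full _ (measurableTypeR R) R unit_uniform _ _ mE _ I1)//.
congr (unit_uniform _); apply/seteqP; split=> x /=; rewrite !in_itv/=.
  by move=> [h xI]; apply/lP.
move=> h; suff xI : 0 <= x < 1 by split => //; apply/lP.
by move/andP: h => [? ?]; apply/andP; split; lra.
Qed.

(** Prescribing one more digit splits an event into two, and if both halves have
    the expected size then so has the whole. So the induction goes down from the
    case where all digits below some n are prescribed, that is, on the number k
    of digits below n that are free. *)
Lemma uniform_digits (s : seq nat) (f : nat -> bool) : uniq s ->
  unit_uniform [set x | forall i, i \in s -> digit i x = f i] =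
    (2^-1 ^+ size s)%:E.
Proof.
have [n sn] : exists n, all (gtn n) s.
  exists (\max_(i <- s) i).+1; apply/allP => i si /=.
  by rewrite ltnS; apply: leq_bigmax_seq.
have [k nk] : exists k, (n - size s = k)%N by eexists.
elim: k s f sn nk => [|k IHk] s f sn nk us.
  have ss : {subset s <= iota 0 n}.
    by move=> i /(allP sn)/=; rewrite mem_iota.
  have sz : (size (iota 0 n) <= size s)%N.
    by rewrite size_iota -subn_eq0 nk.
  have [sE eqs] := uniq_min_size us ss sz.
  rewrite sE size_iota -(uniform_digits_prefix n f).
  congr (unit_uniform _); apply/seteqP; split=> x /= h i hi; apply: h.
    by rewrite eqs mem_iota.
  by move: hi; rewrite eqs mem_iota.
have [j jn js] : exists2 j, (j < n)%N & j \notin s.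
  have : ~~ all (mem s) (iota 0 n).
    apply/negP => /allP h; have := uniq_leq_size (iota_uniq 0 n) h.
    by rewrite size_iota -subn_eq0 nk.
  by case/allPn => j; rewrite mem_iota => /andP[_ jn] js; exists j.
pose g b i := if i == j then b else f i.
have half b : unit_uniform [set x | forall i, i \in j :: s -> digit i x = g b i]
    = (2^-1 ^+ (size s).+1)%:E.
  apply: IHk; [by rewrite /= sn andbT|by rewrite /=; lia|by rewrite /= js].
rewrite (_ : [set x | _] =
    [set x | forall i, i \in j :: s -> digit i x = g true i] `|`
    [set x | forall i, i \in j :: s -> digit i x = g false i]).
  rewrite measureU; [|exact: measurable_digits|exact: measurable_digits|].
    apply: etrans (congr2 adde (half true) (half false)) _.
    transitivity ((2^-1 ^+ (size s).+1 + 2^-1 ^+ (size s).+1 : R)%:E); first by [].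
    by rewrite exprS; congr EFin; lra.
  rewrite -subset0 => x [/= h1 h2].
  by have := h1 j; have := h2 j; rewrite mem_head /g eqxx => -> // /(_ erefl).
have gs b i : i \in s -> g b i = f i.
  by move=> si; rewrite /g; case: eqP si js => // -> ->.
apply/seteqP; split=> x /=.
  move=> h; case e: (digit j x); [left|right] => i.
    rewrite inE => /predU1P[->|si]; first by rewrite e /g eqxx.
    by rewrite gs// h.
  rewrite inE => /predU1P[->|si]; first by rewrite e /g eqxx.
  by rewrite gs// h.
by case=> h i si; rewrite h ?inE ?si ?orbT// gs.
Qed.

End digits.

Definition digit_field {R : realType} (x : measurableTypeR R) : field :=
  fun p => digit (pickle p) x.

Lemma measurable_digit_field {R : realType} :
  measurable_fun setT (@digit_field R).
Proof. by apply: measurable_to_field => p; exact: measurable_digit. Qed.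

HB.instance Definition _ {R : realType} := isMeasurableFun.Build _ _ _ _
  (@digit_field R) measurable_digit_field.

Definition coin (R : realType) : probability field R :=
  distribution unit_uniform (@digit_field R).

Lemma coin_cylinder (R : realType) (s : seq site) (f : field) : uniq s ->
  coin R [set w | forall p, p \in s -> w p = f p] = (2^-1 ^+ size s)%:E.
Proof.
move=> us; pose g i := if unpickle i is Some p then f p else false.
rewrite -(size_map pickle) -(@uniform_digits _ _ g); last first.
  by rewrite map_inj_uniq//; exact: pcan_inj pickleK.
congr (unit_uniform _); apply/seteqP; split=> x /= h p.
  by case/mapP=> q qs ->; rewrite /g pickleK; exact: h.
by move=> ps; rewrite [LHS]h ?map_f// /g pickleK.
Qed.

(** * Independence and symmetries of the coins *)


Lemma measurable_preim d d' (T : measurableType d) (T' : measurableType d')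
    (f : T -> T') (A : set T') :
  measurable_fun setT f -> measurable A -> measurable (f @^-1` A).
Proof. by move=> mf mA; rewrite -[X in measurable X]setTI; exact: mf. Qed.

Lemma measurable_cylinder (s : seq site) (f : field) :
  measurable [set w : field | forall p, p \in s -> w p = f p].
Proof.
elim: s => [|q s IHs].
  by rewrite (_ : [set _ | _] = setT)//; apply/seteqP; split.
rewrite (_ : [set _ | _] = (if f q then [set w : field | w q]
   else ~` [set w | w q]) `&` [set w : field | forall p, p \in s -> w p = f p]).
  apply: measurableI => //; case: (f q); first exact: measurable_site.
  by apply: measurableC; exact: measurable_site.
apply/seteqP; split=> w /= => [h|[hq h] p].
  split=> [|p sp]; last by apply: h; rewrite inE sp orbT.
  by have := h q; rewrite mem_head => /(_ erefl) <-; case e: (w q) => //=; rewrite e.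
rewrite inE => /predU1P[->|/h//]; move: hq; case: (f q) => //=.
by move/negP/negbTE.
Qed.

Definition all_heads (s : seq site) : set field :=
  [set w | forall p, p \in s -> w p].

Lemma all_headsE s :
  all_heads s = [set w | forall p, p \in s -> w p = (fun=> true) p].
Proof. by apply/seteqP; split=> w /= h p ps; apply: h. Qed.

Lemma measurable_all_heads s : measurable (all_heads s).
Proof. by rewrite all_headsE; exact: measurable_cylinder. Qed.

Section coin_theory.
Context {R : realType}.
Notation mu := (coin R).

Lemma coin_all_heads s : uniq s -> mu (all_heads s) = (2^-1 ^+ size s)%:E.
Proof. by move=> us; rewrite all_headsE; exact: coin_cylinder. Qed.

(** The events all_heads s are closed under intersection and generate the
    sigma-algebra, so they determine a probability on configurations. *)
Lemma coin_unique (nu : probability field R) :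
  (forall s, uniq s -> nu (all_heads s) = (2^-1 ^+ size s)%:E) ->
  forall A, measurable A -> nu A = mu A.
Proof.
move=> nuE A mA.
pose G : set (set field) := [set all_heads s | s in [set s | uniq s]].
apply: (measure_unique G (fun=> setT)) => //.
- apply/seteqP; split.
    apply: sub_sigma_algebra2 => _ [p _ <-]; exists [:: p] => //.
    apply/seteqP; split=> w /=; first by apply; rewrite mem_head.
    by move=> wp q; rewrite inE => /eqP ->.
  apply: smallest_sub; first exact: sigma_algebra_measurable.
  by move=> _ [s _ <-]; exact: measurable_all_heads.
- move=> _ _ [s us <-] [t ut <-]; exists (undup (s ++ t)).
    by rewrite /= undup_uniq.
  apply/seteqP; split=> w /= => [h|[hs ht] p].
    by split=> p ps; apply: h; rewrite mem_undup mem_cat ps ?orbT.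
  by rewrite mem_undup mem_cat => /orP[/hs|/ht].
- by move=> _; exists [::] => //; apply/seteqP; split.
- by apply/seteqP; split=> // x _; exists 0%N.
- by move=> _ [s us <-]; exact: etrans (nuE _ us) (esym (coin_all_heads us)).
- by move=> _; rewrite [ltLHS](probability_setT nu) ltry.
Qed.

Definition relabel (s : site -> site) (w : field) : field := fun p => w (s p).

Lemma measurable_relabel s : measurable_fun setT (relabel s).
Proof. by apply: measurable_to_field => p; exact: measurable_site. Qed.

HB.instance Definition _ s := isMeasurableFun.Build _ _ _ _
  (relabel s) (measurable_relabel s).

Lemma coin_relabel (s : site -> site) A : injective s -> measurable A ->
  mu (relabel s @^-1` A) = mu A.
Proof.
move=> si mA; apply: (@coin_unique (distribution mu (relabel s))) => // t ut.
rewrite -(size_map s) -coin_all_heads ?map_inj_uniq//.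
congr (mu _); apply/seteqP; split=> w /= h p; last by move=> pt; exact/h/map_f.
by case/mapP => q qt ->; exact: h.
Qed.

Definition flip (h w : field) : field := fun p => w p (+) h p.

Lemma measurable_flip h : measurable_fun setT (flip h).
Proof.
apply: measurable_to_field => p; rewrite /flip; case: (h p).
  rewrite (_ : [set _ | _] = ~` [set w : field | w p]).
    by apply: measurableC; exact: measurable_site.
  by apply/seteqP; split=> w /=; case: (w p).
rewrite (_ : [set _ | _] = [set w : field | w p]); first exact: measurable_site.
by apply/seteqP; split=> w /=; case: (w p).
Qed.

HB.instance Definition _ h := isMeasurableFun.Build _ _ _ _
  (flip h) (measurable_flip h).

Lemma coin_flip h A : measurable A -> mu (flip h @^-1` A) = mu A.
Proof.
move=> mA; apply: (@coin_unique (distribution mu (flip h))) => // t ut.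
rewrite -(@coin_cylinder _ _ (fun p => ~~ h p))//.
congr (mu _); apply/seteqP; split=> w /= e p pt; have := e p pt.
  by rewrite /flip; case: (w p); case: (h p).
by rewrite /flip => ->; case: (h p).
Qed.

Definition merge (I : set site) (z : field * field) : field :=
  fun p => if p \in I then z.1 p else z.2 p.

Lemma measurable_merge I : measurable_fun setT (merge I).
Proof.
apply: measurable_to_field => p; rewrite /merge; case: (p \in I).
  exact: (measurable_preim measurable_fst (measurable_site p)).
exact: (measurable_preim measurable_snd (measurable_site p)).
Qed.

HB.instance Definition _ I := isMeasurableFun.Build _ _ _ _
  (merge I) (measurable_merge I).

Lemma coin_merge I A : measurable A -> (mu \x mu)%E (merge I @^-1` A) = mu A.
Proof.
move=> mA; apply: (@coin_unique (distribution (mu \x mu)%E (merge I))) => // t ut.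
pose t1 := [seq p <- t | p \in I]; pose t2 := [seq p <- t | p \notin I].
transitivity ((mu \x mu)%E (all_heads t1 `*` all_heads t2)).
  congr ((mu \x mu)%E _); apply/seteqP; split=> -[w1 w2] /= h.
    split=> p; rewrite mem_filter => /andP[pI pt]; have := h p pt.
      by rewrite /merge pI.
    by rewrite /merge (negbTE pI).
  case: h => h1 h2 p pt; rewrite /merge; case: ifP => pI.
    by apply: h1; rewrite mem_filter pI.
  by apply: h2; rewrite mem_filter pI.
apply: etrans (product_measure1E _ _ _ _) _; try exact: measurable_all_heads.
apply: etrans (congr2 mule (coin_all_heads _) (coin_all_heads _)) _.
- exact: filter_uniq.
- exact: filter_uniq.
rewrite -EFinM -exprD !size_filter.
by rewrite -(count_predC (fun p => p \in I) t).
Qed.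

(** Only one direction is asked for: exchanging w and w' gives the other one. *)
Definition depends_on (I : set site) (A : set field) : Prop :=
  forall w w' : field, (forall p, I p -> w p = w' p) -> A w -> A w'.

(** Two independent fields merge into one field of fair coins; A is then read off
    the first of them and B off the second. *)
Lemma independence I J A B : measurable A -> measurable B ->
  depends_on I A -> depends_on J B -> (forall p, I p -> J p -> False) ->
  pr mu (A `&` B) = pr mu A * pr mu B.
Proof.
move=> mA mB dA dB IJ; rewrite /pr.
rewrite -(coin_merge I (measurableI _ _ mA mB)).
have -> : merge I @^-1` (A `&` B) = A `*` B.
  apply/seteqP; split=> -[w1 w2] /= [h1 h2]; split.
  - by apply: dA h1 => p Ip; rewrite /merge mem_set.
  - apply: dB h2 => p Jp; rewrite /merge memNset// => Ip; exact: IJ Ip Jp.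
  - by apply: dA h1 => p Ip; rewrite /merge mem_set.
  - apply: dB h2 => p Jp; rewrite /merge memNset// => Ip; exact: IJ Ip Jp.
by rewrite product_measure1E// fineM// fin_num_measure.
Qed.

Lemma depends_onI I A B : depends_on I A -> depends_on I B ->
  depends_on I (A `&` B).
Proof. by move=> dA dB w w' h [/(dA _ _ h) ? /(dB _ _ h) ?]. Qed.

Lemma depends_onC I A : depends_on I A -> depends_on I (~` A).
Proof.
by move=> dA w w' h nA Aw'; apply: nA; apply: dA Aw' => p /h ->.
Qed.

Lemma depends_onS I J A : I `<=` J -> depends_on I A -> depends_on J A.
Proof. by move=> IJ dA w w' h; apply: dA => p /IJ /h. Qed.

End coin_theory.

(** * Time shifts and mixing *)

Definition later (n : nat) (p : site) : site := (n + p.1.1, p.1.2, p.2)%N.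

Lemma later_inj n : injective (later n).
Proof. by move=> [[i j] k] [[i' j'] k'] [/addnI -> -> ->]. Qed.

Definition time_shift (n : nat) : field -> field := relabel (later n).

HB.instance Definition _ n := MeasurableFun.on (time_shift n).

Lemma time_shift_at n w i l k : time_shift n w (i, l, k) = w ((n + i)%N, l, k).
Proof. by []. Qed.

Lemma time_shiftD m n w : time_shift m (time_shift n w) = time_shift (n + m)%N w.
Proof.
apply/funext => -[[i l] k]; rewrite /time_shift /relabel /later /=.
by rewrite addnA.
Qed.

Lemma time_shift0 w : time_shift 0 w = w.
Proof. by apply/funext => -[[i l] k]. Qed.

Lemma measurable_time_shift n A : measurable A ->
  measurable (time_shift n @^-1` A).
Proof. by apply: measurable_preim; exact: measurable_relabel. Qed.

Definition before (n : nat) : set site := [set p | (p.1.1 < n)%N].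
Definition from (n : nat) : set site := [set p | (n <= p.1.1)%N].

Lemma depends_on_relabel s I A : depends_on I A ->
  depends_on (s @` I) (relabel s @^-1` A).
Proof.
by move=> dA w w' h /=; apply: dA => p Ip; apply: h; exists p.
Qed.

Lemma depends_on_time_shift n A : depends_on (from n) (time_shift n @^-1` A).
Proof.
apply: (@depends_onS (later n @` setT)).
  by move=> _ [p _ <-]; rewrite /from /later /= leq_addr.
apply: depends_on_relabel => w w' h; rewrite (_ : w = w')//.
by apply/funext => p; exact: h.
Qed.

Definition disagree (T : Type) (A B : set T) : set T :=
  (A `&` ~` B) `|` (B `&` ~` A).

Lemma disagreeC (T : Type) (A B : set T) :
  disagree (~` A) (~` B) = disagree A B.
Proof. by rewrite /disagree !setCK setUC; congr (_ `|` _); rewrite setIC. Qed.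

Lemma disagree_trans (T : Type) (A B C : set T) :
  disagree A C `<=` disagree A B `|` disagree B C.
Proof.
move=> x; rewrite /disagree /=.
by case: (pselect (A x)); case: (pselect (B x)); case: (pselect (C x)); tauto.
Qed.

Section mixing.
Context {R : realType}.
Notation mu := (coin R).

Lemma measurable_disagree d (T : measurableType d) (A B : set T) :
  measurable A -> measurable B -> measurable (disagree A B).
Proof.
by move=> mA mB; apply: measurableU; apply: measurableI => //; exact: measurableC.
Qed.

Lemma pr_disagree d (T : measurableType d) (P : probability T R) (A B : set T) :
  measurable A -> measurable B -> `|pr P A - pr P B| <= pr P (disagree A B).
Proof.
move=> mA mB; have mD := measurable_disagree mA mB.
have h (C D : set T) : measurable C -> measurable D ->
    C `&` ~` D `<=` disagree A B -> pr P C <= pr P D + pr P (disagree A B).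
  move=> mC mE CD; rewrite (prDI P mC mE) lerD//.
    by apply: le_pr => //; exact: measurableI.
  by apply: le_pr => //; apply: measurableI => //; exact: measurableC.
have h1 := h A B mA mB (fun x h => or_introl h).
have h2 := h B A mB mA (fun x h => or_intror h).
by rewrite ler_norml; apply/andP; split; lra.
Qed.

Lemma pr_time_shift n A : measurable A -> pr mu (time_shift n @^-1` A) = pr mu A.
Proof. by move=> mA; congr fine; apply: coin_relabel => //; exact: later_inj. Qed.

Definition approximable (A : set field) : Prop := forall e : R, 0 < e ->
  exists n B, [/\ measurable B, depends_on (before n) B &
    pr mu (disagree A B) < e].

Lemma approximableC A : approximable A -> approximable (~` A).
Proof.
move=> aA e /aA[n [B [mB dB AB]]]; exists n, (~` B); split.
- exact: measurableC.
- exact: depends_onC.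
- by rewrite disagreeC.
Qed.

Lemma approximableU A B : measurable A -> measurable B ->
  approximable A -> approximable B -> approximable (A `|` B).
Proof.
move=> mA mB aA aB e e0; have e20 : 0 < e / 2 by rewrite divr_gt0.
have [n [A' [mA' dA' AA']]] := aA _ e20.
have [m [B' [mB' dB' BB']]] := aB _ e20.
exists (maxn n m), (A' `|` B'); split; first exact: measurableU.
  move=> w w' h [Aw|Bw]; [left|right].
    by apply: dA' Aw => p; rewrite /before /= => pn; apply: h; rewrite /before/= leq_max pn.
  by apply: dB' Bw => p; rewrite /before /= => pn; apply: h; rewrite /before/= leq_max pn orbT.
have mD := measurable_disagree mA mA'; have mE := measurable_disagree mB mB'.
apply: (@le_lt_trans _ _ (pr mu (disagree A A' `|` disagree B B'))).
  apply: le_pr; [|exact: measurableU|].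
    by apply: measurable_disagree; exact: measurableU.
  by move=> w; rewrite /disagree /=; tauto.
apply: le_lt_trans (prU_le _ mD mE) _; lra.
Qed.

(** The approximable events form a sigma-algebra: a countable union is nearly
    exhausted by a finite one. *)
Lemma measurable_approximable A : measurable A -> approximable A.
Proof.
pose G : set (set field) := [set A | measurable A /\ approximable A].
suff sG : sigma_algebra setT G.
  suff sub : @measurable _ field `<=` G by move=> /sub[].
  apply: smallest_sub => // _ [p _ <-]; split; first exact: measurable_site.
  move=> e e0; exists p.1.1.+1, [set w | w p]; split.
  - exact: measurable_site.
  - by move=> w w' h /=; rewrite (h p)// /before /= ltnS.
  - by rewrite /disagree setICr setU0 pr_set0.
split.
- split => // e e0; exists 0%N, set0; split => //.
  by rewrite /disagree set0I setU0 pr_set0.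
- move=> B [mB aB]; rewrite setTD; split; first exact: measurableC.
  exact: approximableC.
move=> F GF.
have mF i : measurable (F i) by case: (GF i).
have mU : measurable (\bigcup_i F i) by exact: bigcupT_measurable.
split => // e e0.
pose H n := \bigcup_(i in [set i | (i < n)%N]) F i.
have HS n : H n.+1 = F n `|` H n.
  apply/seteqP; split=> w /=.
    move=> [i /=]; rewrite ltnS leq_eqVlt => /predU1P[->|lin] Fw; first by left.
    by right; exists i.
  by case=> [Fw|[i /= lin Fw]]; [exists n => /=|exists i => //=; exact: ltnW].
have H0 : H 0%N = set0 by apply/seteqP; split=> w //= [].
have mH n : measurable (H n) by apply: bigcup_measurable => i _; exact: mF.
have aH n : approximable (H n).
  elim: n => [|n IHn].
    rewrite H0 => e' e'0; exists 0%N, set0; split => //.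
    by rewrite /disagree set0I setU0 pr_set0.
  by rewrite HS; apply: approximableU => //; case: (GF n).
have HU : \bigcup_n H n = \bigcup_i F i.
  apply/seteqP; split=> w /= [i _]; last by move=> Fw; exists i.+1 => //; exists i => /=.
  by case=> j _ Fw; exists j.
have ndH : nondecreasing_seq H.
  move=> n m nm; apply/subsetPset => w [i /= lin Fw]; exists i => //=.
  exact: leq_trans lin nm.
have e20 : 0 < e / 2 by rewrite divr_gt0.
have [N hN] := pr_nondecreasing_lim mu mH ndH e20.
have [n [B [mB dB HB]]] := aH N _ e20.
exists n, B; split => //.
apply: le_lt_trans (_ : _ <= pr mu (disagree (\bigcup_i F i) (H N)) +
  pr mu (disagree (H N) B)) _.
  apply: le_trans (prU_le _ _ _); try exact: measurable_disagree.
  apply: le_pr; [| |exact: disagree_trans]; first exact: measurable_disagree.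
  by apply: measurableU; exact: measurable_disagree.
suff : pr mu (disagree (\bigcup_i F i) (H N)) < e / 2 by lra.
have -> : disagree (\bigcup_i F i) (H N) = \bigcup_i F i `&` ~` H N.
  rewrite /disagree (_ : H N `&` _ = set0) ?setU0//.
  by rewrite -subset0 => w [[i _ Fw] nU]; apply: nU; exists i.
have := prDI mu mU (mH N); rewrite -{1}HU.
rewrite (_ : \bigcup_i F i `&` H N = H N); first by rewrite HU in hN *; lra.
by apply/setIidPr => w [i _ Fw]; exists i.
Qed.

(** An event decided before time n is independent of the coins from time n on,
    and every event is nearly of this kind. *)
Lemma mixing A B (e : R) : measurable A -> measurable B -> 0 < e ->
  exists N, forall n, (N <= n)%N ->
    `|pr mu (A `&` time_shift n @^-1` B) - pr mu A * pr mu B| < e.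
Proof.
move=> mA mB e0; have e20 : 0 < e / 2 by rewrite divr_gt0.
have [N [C [mC dC AC]]] := measurable_approximable mA e20.
exists N => n Nn; set D := time_shift n @^-1` B.
have mD : measurable D by exact: measurable_time_shift.
have CD : pr mu (C `&` D) = pr mu C * pr mu B.
  rewrite -(pr_time_shift n mB).
  apply: (independence mC mD dC (@depends_on_time_shift n B)) => p.
  by rewrite /before /from /= => pN np; lia.
have mAD : measurable (A `&` D) by exact: measurableI.
have mCD : measurable (C `&` D) by exact: measurableI.
have h1 := pr_disagree mu mAD mCD.
have h2 := pr_disagree mu mA mC.
have h3 : pr mu (disagree (A `&` D) (C `&` D)) <= pr mu (disagree A C).
  apply: le_pr; try exact: measurable_disagree.
  by move=> w; rewrite /disagree /=; tauto.
have h4 : `|pr mu C * pr mu B - pr mu A * pr mu B| <= `|pr mu A - pr mu C|.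
  rewrite -mulrBl normrM distrC ler_piMr// ger0_norm ?pr_ge0//; exact: pr_le1.
rewrite -CD in h4; apply: le_lt_trans (ler_distD (pr mu (C `&` D)) _ _) _.
lra.
Qed.

(** By mixing an invariant event is independent of itself. *)
Lemma invariant_pr01 A : measurable A -> time_shift 1 @^-1` A = A ->
  pr mu A = 0 \/ pr mu A = 1.
Proof.
move=> mA iA.
have iAn n : time_shift n @^-1` A = A.
  elim: n => [|n IHn]; first by apply/seteqP; split=> w /=; rewrite time_shift0.
  rewrite -[RHS]iA -{2}IHn; apply/seteqP; split=> w /=;
    by rewrite time_shiftD add1n.
have small (e : R) : 0 < e -> `|pr mu A - pr mu A * pr mu A| <= e.
  move=> e0; have [N /(_ N (leqnn N))] := mixing mA mA e0.
  by rewrite iAn setIid => /ltW.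
have le0 : `|pr mu A - pr mu A * pr mu A| <= 0.
  by apply/ler_addgt0Pr => e e0; rewrite add0r; exact: small.
have /eqP : pr mu A * (1 - pr mu A) = 0.
  by rewrite mulrBr mulr1; apply/eqP; rewrite -normr_eq0 eq_le le0 normr_ge0.
rewrite mulf_eq0 => /orP[/eqP ->|/eqP h]; first by left.
by right; lra.
Qed.

Lemma eventually_returns A : measurable A -> 0 < pr mu A ->
  exists N, forall n, (N <= n)%N -> 0 < pr mu (A `&` time_shift n @^-1` A).
Proof.
move=> mA A0; have [N hN] := mixing mA mA (mulr_gt0 A0 A0); exists N => n /hN.
by rewrite ltr_norml => /andP[h _]; lra.
Qed.

(** An event that avoids Z and is carried into itself by a shift past the sites
    of Z satisfies pr A <= (1 - pr Z) * pr A. *)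
Lemma pr_avoiding_null n Z A : measurable Z -> measurable A ->
  depends_on (before n) Z -> 0 < pr mu Z -> A `<=` ~` Z ->
  A `<=` time_shift n @^-1` A -> pr mu A = 0.
Proof.
move=> mZ mA dZ Z0 AZ AA; have mC := measurableC mZ.
have : pr mu A <= pr mu (~` Z `&` time_shift n @^-1` A).
  apply: le_pr => //; last by move=> w Aw; split; [exact: AZ|exact: AA].
  by apply: measurableI => //; exact: measurable_time_shift.
rewrite (independence mC (@measurable_time_shift n _ mA) (depends_onC dZ)
  (@depends_on_time_shift n A)); last first.
  by move=> p; rewrite /before /from /=; lia.
by rewrite pr_time_shift// prC//; have := pr_ge0 mu A; nra.
Qed.

End mixing.

(** * Codings of the coins as stationary processes *)

Lemma measurable_coordinate d (S : measurableType d) (i : nat) (Y : set S) :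
  measurable Y -> measurable [set x : path_space S | Y (x i)].
Proof.
move=> mY; apply: sub_sigma_algebra; exists i => //; exists Y => //.
by rewrite setTI.
Qed.

Lemma measurable_to_path d d' (T : measurableType d) (S : measurableType d')
    (f : T -> path_space S) :
  (forall i, measurable_fun setT (fun t => f t i)) -> measurable_fun setT f.
Proof.
move=> mf.
refine (@measurability _ _ T (path_space S) setT f (@coordinate_sets _ S) erefl _).
move=> _ [_ [i _ [Y mY <-]] <-]; rewrite !setTI.
exact: measurable_preim (mf i) mY.
Qed.

Lemma measurable_word_at m (u : seq bool) : measurable (word_at m u).
Proof.
rewrite (_ : word_at m u = \bigcap_(i in [set i | (i < size u)%N])
   [set x : path_space bool | x (m + i)%N = nth false u i]).
  apply: bigcap_measurableType => i _.
  exact: (@measurable_coordinate _ bool (m + i) [set nth false u i]).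
apply/seteqP; split=> x /=.
  by move=> e i /= iu; rewrite -e nth_mkseq.
move=> h; apply: (@eq_from_nth _ false); first by rewrite size_mkseq.
by move=> i; rewrite size_mkseq => iu; rewrite nth_mkseq// h.
Qed.

Section factors.
Context {d : measure_display} {S : measurableType d}.

Definition factor_path (phi : field -> S) (w : field) : path_space S :=
  fun n => phi (time_shift n w).

Lemma measurable_factor_path (phi : {mfun field >-> S}) :
  measurable_fun setT (factor_path phi).
Proof.
apply: measurable_to_path => i; apply: (measurableT_comp (f := phi)) => //.
Qed.

HB.instance Definition _ (phi : {mfun field >-> S}) :=
  isMeasurableFun.Build _ _ _ _ (factor_path phi) (measurable_factor_path phi).

Definition factor (R : realType) (phi : {mfun field >-> S}) :
  probability (path_space S) R := distribution (coin R) (factor_path phi).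

Lemma factorE (R : realType) (phi : {mfun field >-> S}) E :
  factor R phi E = coin R (factor_path phi @^-1` E).
Proof. by []. Qed.

Lemma measurable_factor_preim (phi : {mfun field >-> S}) E :
  measurable E -> measurable (factor_path phi @^-1` E).
Proof. exact: measurable_preim (measurable_factor_path phi). Qed.

Lemma shift_factor_path (phi : field -> S) w :
  Defs.shift (factor_path phi w) = factor_path phi (time_shift 1 w).
Proof. by apply/funext => n; rewrite /Defs.shift /factor_path time_shiftD add1n. Qed.

Lemma factor_stationary (R : realType) (phi : {mfun field >-> S}) :
  stationary (factor R phi).
Proof.
move=> E mE; rewrite !factorE.
rewrite (_ : _ @^-1` (Defs.shift @^-1` E) =
  time_shift 1 @^-1` (factor_path phi @^-1` E)).
  apply: coin_relabel; [exact: later_inj|exact: measurable_factor_preim].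
by apply/seteqP; split=> w /=; rewrite shift_factor_path.
Qed.

Lemma factor_ergodic (R : realType) (phi : {mfun field >-> S}) :
  ergodic (factor R phi).
Proof.
move=> E mE iE; rewrite !factorE; have mB := measurable_factor_preim phi mE.
rewrite !(prE _ mB); suff : pr (coin R) (factor_path phi @^-1` E) = 0 \/
  pr (coin R) (factor_path phi @^-1` E) = 1 by case=> ->; [left|right].
apply: invariant_pr01 => //; rewrite -[in RHS]iE.
by apply/seteqP; split=> w /=; rewrite shift_factor_path.
Qed.

End factors.

Lemma factor_path_word (phi : field -> bool) m (u : seq bool) :
  factor_path phi @^-1` (word_at m u) =
  time_shift m @^-1` (factor_path phi @^-1` (word_at 0 u)).
Proof.
have e w : mkseq (fun i => factor_path phi w (m + i)%N) (size u) =
    mkseq (fun i => factor_path phi (time_shift m w) (0 + i)%N) (size u).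
  by apply: eq_mkseq => i; rewrite /factor_path time_shiftD add0n.
by apply/seteqP; split=> w; rewrite /word_at /=; rewrite e.
Qed.

(** By mixing every block of positive probability can return after each of two
    consecutive numbers of steps. *)
Lemma factor_aperiodic (R : realType) k (phi : {mfun field >-> bool}) :
  aperiodic k (factor R phi).
Proof.
move=> v vk v0 q qP; pose A := factor_path phi @^-1` (word_at 0 v).
have mA : measurable A by apply: measurable_factor_preim; exact: measurable_word_at.
have {}v0 : 0 < pr (coin R) A by apply/pr_gt0.
have [N NP] := eventually_returns mA v0.
have ret n : (N < n)%N -> (q %| n)%N.
  move=> Nn; apply: qP; first exact: leq_ltn_trans Nn.
  rewrite factorE preimage_setI [X in _ `&` X]factor_path_word.
  apply/pr_gt0; last by apply: NP; exact: ltnW.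
  by apply: measurableI => //; exact: measurable_time_shift.
have r1 := ret N.+1 (ltnSn N); have r2 := ret N.+2 (leqnSn N.+1).
by apply/eqP; rewrite -dvdn1 -(dvdn_addr 1 r1) addn1.
Qed.

(** The two codings of the same coins, run side by side, form a joining. *)
Lemma dbar_factor_le (R : realType) (P : process R) (phi psi : {mfun field >-> bool}) :
  same_distribution (factor R phi) P ->
  (dbar P (factor R psi) <= (pr (coin R) [set w | phi w != psi w])%:E)%E.
Proof.
move=> samP; apply: ge_ereal_inf; exists (pr (coin R) [set w | phi w != psi w])%:E => //.
exists (pr (coin R) [set w | phi w != psi w]) => //.
have mp : measurable_fun setT (fun w => (phi w, psi w)) by exact: measurable_fun_pair.
pose pair : {mfun field >-> (bool * bool)%type} :=
  HB.pack (fun w : field => (phi w, psi w)) (isMeasurableFun.Build _ _ _ _ _ mp).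
have mD : measurable [set w | phi w != psi w].
  apply/measurable_boolP; rewrite (_ : (fun _ => _) = (fun w => phi w (+) psi w)).
    have -> : (fun w => phi w (+) psi w) =
        (fun w => if phi w then ~~ psi w else psi w).
      by apply/funext => w; case: (phi w).
    by apply: measurable_fun_ifT => //; exact: measurable_neg.
  by apply/funext => w; case: (phi w); case: (psi w).
exists (factor R pair); split; last by rewrite factorE -prE.
split.
- exact: factor_stationary.
- by move=> E mE; rewrite -samP.
- by [].
Qed.

(** * A cycle of marker, data and idle time *)

Section marked_cycle.
Variables (M K m : nat).
Hypotheses (M_gt0 : (0 < M)%N).
Local Notation N := (M + K)%N.

(** The phases of the cycle: 0 is idle time, which ends when the coin c shows
    heads; 1, ..., M write the marker; M + 1, ..., M + K write data. *)
Definition cycle_step (c : bool) (s : nat) : nat :=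
  if s == 0%N then nat_of_bool c else if (s < N)%N then s.+1 else 0%N.

(** The phases at which the letter of the data is shown. The first m.+1 data
    phases are suppressed so that the data, which look m steps ahead, do not
    reach beyond the marker; the multiples of M are suppressed so that the data
    contain no run of M ones. *)
Definition live (s : nat) : bool := (M + m.+1 < s)%N && ~~ (M %| s)%N.

Definition letter (s : nat) (b : bool) : bool :=
  (0 < s <= M)%N || (live s && b).

Lemma cycle_step_le c s : (s <= N)%N -> (cycle_step c s <= N)%N.
Proof.
by case: s => [|s]; rewrite /cycle_step /=; [case: c => /=; lia|case: ifP; lia].
Qed.

Lemma cycle_stepS c s t : cycle_step c s = t.+1 -> s = t.
Proof.
case: s => [|s]; rewrite /cycle_step /=; first by case: c => // -[<-].
by case: ifP => [_ [->]|_].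
Qed.

Lemma cycle_step_up c s : (0 < s < N)%N -> cycle_step c s = s.+1.
Proof. by rewrite /cycle_step => /andP[s0 ->]; case: eqP s0 => // ->. Qed.

Section trajectory.
Variables (s : nat -> nat) (c b : nat -> bool).
Hypotheses (s_step : forall j, s j = cycle_step (c j) (s j.+1))
           (s_le : forall j, (s j <= N)%N).
Local Notation y j := (letter (s j) (b j)).

(** The phase at time j comes from the phase at time j.+1, so that the cycle is
    traversed downwards as the index grows. *)
Lemma trajectory_down j r : (r <= s j)%N -> s (j + r)%N = (s j - r)%N.
Proof.
elim: r => [|r IHr] rs; first by rewrite addn0 subn0.
have := IHr (ltnW rs); rewrite addnS s_step => e.
have [t tE] : exists t, (s j - r = t.+1)%N by exists (s j - r.+1)%N; lia.
by rewrite tE in e; rewrite (cycle_stepS e); lia.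
Qed.

Lemma trajectory_up j i : s (j + i)%N = M -> (i <= K)%N -> s j = (M + i)%N.
Proof.
elim: i j => [|i IHi] j; first by rewrite !addn0.
rewrite addnS -addSn => /IHi h iK; rewrite s_step h ?cycle_step_up ?addnS//; lia.
Qed.

(** A run of M ones is a marker. If it started in the data, the phases that it
    meets would include a multiple of M; a multiple above M is not live, and the
    multiple M itself is met only after M.+1, which is not live either. *)
Lemma marker_phase j : (forall r, (r < M)%N -> y (j + r)%N) <-> s j = M.
Proof.
split=> [ones|sM r rM]; last first.
  by rewrite /letter trajectory_down ?sM//; lia.
case: (ltngtP (s j) M) => // sj.
  have letter0 bj : letter 0 bj = false by [].
  by have := ones _ sj; rewrite trajectory_down// subnn letter0.
pose r := (s j %% M)%N.
have rM : (r < M)%N by rewrite ltn_mod.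
have rs : (r <= s j)%N by apply: leq_trans (ltnW rM) (ltnW sj).
have dvd : (M %| s j - r)%N by rewrite /r {1}(divn_eq (s j) M) addnK dvdn_mull.
have := ones _ rM; rewrite trajectory_down// /letter /live dvd andbF orbF.
move=> /andP[_ le].
have eM : (s j - r = M)%N.
  by apply/eqP; rewrite eqn_leq le dvdn_leq//; lia.
have r1 : (r.-1 < M)%N by lia.
have := ones _ r1; rewrite trajectory_down; last by lia.
by rewrite /letter /live => /orP[/andP[_ h]|/andP[/andP[h _] _]]; lia.
Qed.

End trajectory.
End marked_cycle.

(** * The Markov property in terms of word probabilities *)

Section words.
Context {R : realType} (psi : {mfun field >-> bool}).
Notation mu := (coin R).

Definition emits (x : seq bool) : set field := factor_path psi @^-1` word_at 0 x.
Definition word_prob (x : seq bool) : R := pr mu (emits x).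

Lemma measurable_emits x : measurable (emits x).
Proof. by apply: measurable_factor_preim; exact: measurable_word_at. Qed.

Lemma emitsP x w :
  emits x w <-> forall i, (i < size x)%N -> psi (time_shift i w) = nth false x i.
Proof.
rewrite /emits /word_at /=; split=> [e i ix|h].
  by rewrite -[RHS](congr1 (nth false ^~ i) e) nth_mkseq.
apply: (@eq_from_nth _ false); first by rewrite size_mkseq.
by move=> i; rewrite size_mkseq => ix; rewrite nth_mkseq//; exact: h.
Qed.

Lemma emits_cat x z w :
  emits (x ++ z) w <-> emits x w /\ emits z (time_shift (size x) w).
Proof.
rewrite !emitsP size_cat; split=> [h|[hx hz] i].
  split=> i ix; first by rewrite h ?nth_cat ?ix//; exact: ltn_addr.
  rewrite time_shiftD h ?ltn_add2l// nth_cat ltnNge leq_addr /=.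
  by rewrite addKn.
rewrite nth_cat; case: (ltnP i (size x)) => [ix _|xi ixz]; first exact: hx.
have := hz (i - size x)%N; rewrite time_shiftD subnKC// => -> //.
by rewrite ltn_subLR.
Qed.

Lemma emits_cons a x w :
  emits (a :: x) w <-> psi w = a /\ emits x (time_shift 1 w).
Proof.
rewrite -cat1s emits_cat; split=> -[h ?]; split=> //.
  by move/emitsP : h => /(_ 0%N isT) /=; rewrite time_shift0.
by apply/emitsP => -[|//] _ /=; rewrite time_shift0.
Qed.

Lemma emits_catE x z :
  emits (x ++ z) = emits x `&` time_shift (size x) @^-1` emits z.
Proof. by apply/seteqP; split=> w; rewrite emits_cat. Qed.

Lemma word_prob_cat_lel x z : word_prob (x ++ z) <= word_prob x.
Proof.
by apply: le_pr => [||w /emits_cat[]//]; exact: measurable_emits.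
Qed.

Lemma word_prob_cat_ler x z : word_prob (x ++ z) <= word_prob z.
Proof.
rewrite /word_prob -(pr_time_shift (size x) (measurable_emits z)).
apply: le_pr => [||w /emits_cat[]//]; first exact: measurable_emits.
by apply: measurable_time_shift; exact: measurable_emits.
Qed.

(** The factorization says that a letter and the word after the next k letters
    are independent given these k letters. This is the Markov property of the
    time-reversed process; it only involves products of word probabilities and
    so passes to the process itself. *)
Lemma markov_of_reversed k :
  (forall a v, size v = k -> exists (alpha beta : R) (E : seq bool -> R),
    forall u, word_prob (a :: v ++ u) = alpha * E u /\
              word_prob (v ++ u) = beta * E u) ->
  Defs.markov k (factor R psi).
Proof.
move=> rev.
have rev2 a v u : size v = k ->
    word_prob (a :: v ++ u) * word_prob v = word_prob (a :: v) * word_prob (v ++ u).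
  move=> /(rev a)[al [be [E hE]]]; have [h1 h2] := hE u.
  have [h3 h4] := hE [::]; rewrite cats0 in h3 h4.
  by rewrite h1 h2 h3 h4; ring.
have fwd u v a : size v = k ->
    word_prob (u ++ v ++ [:: a]) * word_prob v =
    word_prob (u ++ v) * word_prob (v ++ [:: a]).
  move=> vk; elim: u => [|b u IHu]; first by rewrite mulrC.
  rewrite !cat_cons catA in IHu *; set x := u ++ v in IHu *.
  have kx : (k <= size x)%N by rewrite size_cat vk leq_addl.
  have tk : size (take k x) = k by rewrite size_takel.
  have e1 := rev2 b (take k x) (drop k x) tk.
  have e2 := rev2 b (take k x) (drop k x ++ [:: a]) tk.
  rewrite catA !cat_take_drop in e1 e2.
  have [p0|p0] := eqVneq (word_prob (take k x)) 0.
    have z1 : word_prob (b :: x) = 0.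
      apply/eqP; rewrite eq_le /word_prob pr_ge0 andbT -/(word_prob _) -p0.
      rewrite -cat1s -[x in X in X <= _](cat_take_drop k) catA.
      apply: le_trans (word_prob_cat_lel _ _) _; exact: word_prob_cat_ler.
    have z2 : word_prob (b :: x ++ [:: a]) = 0.
      apply/eqP; rewrite eq_le /word_prob pr_ge0 andbT -/(word_prob _) -z1.
      exact: (word_prob_cat_lel (b :: x)).
    by rewrite z1 z2 !mul0r.
  have alg (B B2 X X2 Q A V W : R) : Q != 0 -> B2 * Q = A * X2 ->
      B * Q = A * X -> X2 * V = X * W -> B2 * V = B * W.
    move=> Q0 h2 h1 h; apply: (mulIf Q0).
    by rewrite mulrAC h2 -mulrA h mulrA -h1 mulrAC.
  exact: alg p0 e2 e1 IHu.
move=> u v a vk uvP.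
have uv0 : 0 < word_prob (u ++ v).
  by apply: (iffLR (pr_gt0 mu (measurable_emits (u ++ v)))); exact: uvP.
have v0 : 0 < word_prob v by exact: lt_le_trans (word_prob_cat_ler u v).
rewrite /cond_prob; set x := u ++ v in uv0 *.
have -> : fine (factor R psi (word_at (size x) [:: a] `&` word_at 0 x)) =
    word_prob (x ++ [:: a]).
  rewrite /word_prob emits_catE /pr factorE preimage_setI (factor_path_word _ (size x)).
  by rewrite setIC.
have -> : fine (factor R psi (word_at (size x) [:: a] `&` word_at (size u) v)) =
    word_prob (v ++ [:: a]).
  rewrite /word_prob emits_catE -(pr_time_shift (size u)); last first.
    by rewrite -emits_catE; exact: measurable_emits.
  rewrite /pr factorE preimage_setI (factor_path_word _ (size x)).
  rewrite (factor_path_word _ (size u)) preimage_setI setIC.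
  congr (fine (mu (_ `&` _))); apply/seteqP; split=> w /=;
    by rewrite time_shiftD /x size_cat.
have -> : fine (factor R psi (word_at (size u) v)) = word_prob v.
  by rewrite /word_prob -(pr_time_shift (size u) (measurable_emits v)) factorE
    (factor_path_word _ (size u)).
have -> : fine (factor R psi (word_at 0 x)) = word_prob x by [].
have := fwd u v a vk; rewrite catA -/x => e.
apply/eqP; rewrite eqr_div ?lt0r_neq0//; apply/eqP.
by rewrite e mulrC.
Qed.

End words.

(** * The phase of the cycle as a function of the coins *)

Section phase.
Context {R : realType} (M K : nat).
Hypothesis M_gt0 : (0 < M)%N.
Notation mu := (coin R).
Local Notation N := (M + K)%N.
Local Notation step := (cycle_step M K).

(** The phase at time 0 when the phase at time t is s. *)
Fixpoint run (w : field) (t s : nat) : nat :=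
  if t is t'.+1 then run w t' (step (w (t', 0, 0)%N) s) else s.

Lemma run_time_shift w t s :
  run w t.+1 s = step (w (0, 0, 0)%N) (run (time_shift 1 w) t s).
Proof. by elim: t s => [//|t IHt] s; rewrite [LHS]IHt. Qed.

Lemma run_le w t s : (s <= N)%N -> (run w t s <= N)%N.
Proof. by elim: t s => [//|t IHt] s sN; apply: IHt; exact: cycle_step_le. Qed.

Definition coalesced (w : field) (t v : nat) : Prop :=
  forall s, (s <= N)%N -> run w t s = v.

Lemma coalesced_add w t r v : coalesced w t v -> coalesced w (t + r) v.
Proof.
move=> wv; elim: r => [|r IHr]; rewrite ?addn0 ?addnS// => s sN.
by apply: IHr; exact: cycle_step_le.
Qed.

Lemma coalesced_unique w t v t' v' : coalesced w t v -> coalesced w t' v' -> v = v'.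
Proof.
move=> /(@coalesced_add _ _ t') h /(@coalesced_add _ _ t) h'.
by rewrite -(h 0%N)// addnC h'.
Qed.

(** The phase of the cycle at time 0, when the cycle is run backwards in time:
    the value on which the runs started at some later time all agree. *)
Definition phase (w : field) : nat := xget 0%N [set v | exists t, coalesced w t v].

Definition sync : set field := [set w | exists t v, coalesced w t v].

Lemma phaseP w t v : coalesced w t v -> phase w = v.
Proof.
move=> wv; rewrite /phase; apply: xget_unique; first by exists t.
by move=> v' [t' wv']; exact: coalesced_unique wv' wv.
Qed.

Lemma phase_le w : (phase w <= N)%N.
Proof.
rewrite /phase; case: xgetP => // v _ [t wv].
by rewrite -(wv 0%N)//; exact: run_le.
Qed.

Lemma phase_step w : sync (time_shift 1 w) ->
  sync w /\ phase w = step (w (0, 0, 0)%N) (phase (time_shift 1 w)).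
Proof.
move=> [t [v wv]]; rewrite (phaseP wv).
have h : coalesced w t.+1 (step (w (0, 0, 0)%N) v).
  by move=> s sN; rewrite run_time_shift wv.
by split; [exists t.+1, (step (w (0, 0, 0)%N) v)|exact: phaseP h].
Qed.

Lemma measurable_run t s v : measurable [set w | run w t s = v].
Proof.
elim: t s => [|t IHt] s.
  case: (eqVneq s v) => [->|sv].
    by rewrite (_ : [set _ | _] = setT)//; apply/seteqP; split.
  rewrite (_ : [set _ | _] = set0)//.
  by apply/seteqP; split=> w //= e; rewrite e eqxx in sv.
have mt := measurable_site (t, 0, 0)%N.
rewrite (_ : [set _ | _] =
    ([set w : field | w (t, 0, 0)%N] `&` [set w | run w t (step true s) = v]) `|`
    (~` [set w : field | w (t, 0, 0)%N] `&` [set w | run w t (step false s) = v])).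
  by apply: measurableU; apply: measurableI => //; exact: measurableC.
apply/seteqP; split=> w /=.
  by case e: (w (t, 0, 0)%N) => h; [left|right].
by case: (w (t, 0, 0)%N) => -[[h1 h2]|[h1 h2]] //; case: h1.
Qed.

Lemma measurable_coalesced t v : measurable [set w | coalesced w t v].
Proof.
rewrite (_ : [set _ | _] =
    \bigcap_(s in [set s | (s <= N)%N]) [set w | run w t s = v])//.
by apply: bigcap_measurableType => s _; exact: measurable_run.
Qed.

Lemma measurable_sync : measurable sync.
Proof.
rewrite (_ : sync = \bigcup_t \bigcup_v [set w | coalesced w t v]).
  by do 2![apply: bigcupT_measurable => ?]; exact: measurable_coalesced.
apply/seteqP; split=> w /=; first by move=> [t [v h]]; exists t => //; exists v.
by move=> [t _ [v _ h]]; exists t, v.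
Qed.

Lemma measurable_phase v : measurable [set w | phase w = v].
Proof.
rewrite (_ : [set _ | _] = (\bigcup_t [set w | coalesced w t v]) `|`
    (if v == 0%N then ~` sync else set0)).
  apply: measurableU; last first.
    by case: eqP => // _; apply: measurableC; exact: measurable_sync.
  by apply: bigcupT_measurable => t; exact: measurable_coalesced.
apply/seteqP; split=> w /=.
  have [[t [v' h]]|nsw] := pselect (sync w).
    by rewrite (phaseP h) => <-; left; exists t.
  rewrite /phase; case: xgetP => [v' _ [t h]|_ <-]; last by right.
  by exfalso; apply: nsw; exists t, v'.
case=> [[t _ h]|]; first exact: phaseP h.
case: eqP => // -> nsw; rewrite /phase; case: xgetP => // v' _ [t h].
by exfalso; apply: nsw; exists t, v'.
Qed.

Lemma run_idle w t s : (forall i, (i < t)%N -> w (i, 0, 0)%N = false) ->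
  (s <= N)%N -> (N < s + t)%N || (s == 0%N) -> run w t s = 0%N.
Proof.
elim: t s => [|t IHt] s w0 sN /=.
  by rewrite addn0 ltnNge sN /= => /eqP.
rewrite (w0 t)// => h; apply: IHt; [by move=> i it; apply/w0/ltnW| |].
  exact: cycle_step_le.
case: s sN h => [|s] sN; first by move=> _; rewrite orbT.
by rewrite /cycle_step /= orbF; case: ifP => _ h; rewrite ?orbT//; apply/orP; left; lia.
Qed.

Lemma sync_time_shift n w : sync (time_shift n w) -> sync w.
Proof.
elim: n w => [|n IHn] w; first by rewrite time_shift0.
by rewrite -add1n -time_shiftD => /IHn /phase_step[].
Qed.

(** A run of N tails forces the cycle into the idle phase whatever its phase was,
    so a field that does not synchronize contains no such run. *)
Lemma pr_sync : pr mu sync = 1.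
Proof.
have mS := measurable_sync.
pose s : seq site := [seq (i, 0, 0)%N | i <- iota 0 N].
pose Z := [set w : field | forall p, p \in s -> w p = (fun=> false) p].
have us : uniq s by rewrite map_inj_uniq ?iota_uniq// => i j [].
suff : pr mu (~` sync) = 0 by rewrite prC//; lra.
apply: (@pr_avoiding_null _ N Z).
- exact: (measurable_cylinder s (fun=> false)).
- exact: measurableC.
- move=> w w' h Zw p ps; rewrite -h; first exact: Zw.
  by case/mapP: ps => i; rewrite mem_iota => /andP[_ iN] ->.
- by rewrite /pr coin_cylinder//= exprn_gt0// invr_gt0.
- move=> w nS Zw; apply: nS; exists N, 0%N => t tN; apply: run_idle => //.
    by move=> i iN; apply: Zw; apply/mapP; exists i => //; rewrite mem_iota.
  by rewrite -[X in (X < _)%N]add0n ltn_add2r lt0n orNb.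
- by move=> w nS /= /sync_time_shift.
Qed.

Definition always_sync : set field := \bigcap_n (time_shift n @^-1` sync).

Lemma measurable_always_sync : measurable always_sync.
Proof.
by apply: bigcapT_measurable => n; apply: measurable_time_shift; exact: measurable_sync.
Qed.

Lemma pr_always_sync : pr mu always_sync = 1.
Proof.
apply: pr_bigcap_full => n; first by apply: measurable_time_shift; exact: measurable_sync.
by rewrite pr_time_shift ?pr_sync//; exact: measurable_sync.
Qed.

Lemma phase_trajectory w : always_sync w -> forall j,
  phase (time_shift j w) =
  step (w (j, 0, 0)%N) (phase (time_shift j.+1 w)).
Proof.
move=> Gw j; have := @phase_step (time_shift j w).
rewrite time_shiftD addn1 => -[]; first exact: Gw.
by move=> _ ->; rewrite time_shift_at addn0.
Qed.

Lemma pr_phase_shift s : (0 < s < N)%N ->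
  pr mu [set w | phase w = s.+1] = pr mu [set w | phase w = s].
Proof.
move=> sN; rewrite -(pr_time_shift 1 (measurable_phase s)).
apply: (eq_pr_on _ _ measurable_always_sync pr_always_sync).
- exact: measurable_phase.
- by apply: measurable_time_shift; exact: measurable_phase.
apply/seteqP; split=> w [/= h Gw]; split => //=.
  have := phase_trajectory Gw 0; rewrite time_shift0 h => e.
  exact: (@cycle_stepS _ _ _ _ _ (esym e)).
by have := phase_trajectory Gw 0; rewrite time_shift0 h => ->; rewrite cycle_step_up.
Qed.

(** Phase 1 is entered from the idle phase when the coin shows heads. *)
Lemma pr_phase0 : (0 < K)%N ->
  pr mu [set w | phase w = 0%N] = 2 * pr mu [set w | phase w = 1%N].
Proof.
move=> K0; have mC := measurable_site (0, 0, 0)%N.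
have mP := @measurable_phase 0%N.
have mTP := @measurable_time_shift 1 _ mP.
have e1 : pr mu [set w | phase w = 1%N] =
    pr mu ([set w : field | w (0, 0, 0)%N] `&` time_shift 1 @^-1` [set w | phase w = 0%N]).
  apply: (eq_pr_on _ _ measurable_always_sync pr_always_sync).
  - exact: measurable_phase.
  - exact: measurableI.
  apply/seteqP; split=> w [/= h Gw]; split => //=;
    have := phase_trajectory Gw 0; rewrite time_shift0.
    rewrite h => e; have e0 := cycle_stepS (esym e); rewrite e0 in e.
    by rewrite e0; split => //; move: e; case: (w _).
  by case: h => -> ->.
rewrite e1 (@independence _ (before 1) (from 1))//; last 3 first.
- by move=> w w' h /=; rewrite (h (0, 0, 0)%N).
- exact: depends_on_time_shift.
- by move=> p; rewrite /before /from /=; lia.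
rewrite pr_time_shift// (_ : pr mu [set w : field | w (0, 0, 0)%N] = 2^-1); first by lra.
have := @coin_cylinder R [:: (0, 0, 0)%N] (fun=> true) isT.
rewrite /= expr1 => h; apply: EFin_inj; rewrite -prE// -h; congr (mu _).
apply/seteqP; split=> w /= {}h; first by move=> p; rewrite inE => /eqP ->.
by rewrite h ?mem_head.
Qed.

End phase.

(** * Marked codings are Markov *)

Section marked.
Context {R : realType} (phi : {mfun field >-> bool}) (m M K : nat).
Hypothesis M_gt0 : (0 < M)%N.
Hypothesis phi_memory : forall w w' : field,
  (forall p, before m p -> w p = w' p) -> phi w = phi w'.
Notation mu := (coin R).
Local Notation N := (M + K)%N.
Local Notation phase := (phase M K).

Definition marked (w : field) : bool := letter M m (phase w) (phi w).

Lemma measurable_marked : measurable_fun setT marked.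
Proof.
apply/measurable_boolP.
have mphi : measurable [set w | phi w] by exact/measurable_boolP.
rewrite (_ : [set _ | _] = \bigcup_s ([set w | phase w = s] `&`
    (if (0 < s <= M)%N then setT else if live M m s then [set w | phi w] else set0))).
  apply: bigcupT_measurable => s; apply: measurableI; first exact: measurable_phase.
  by case: ifP => // _; case: ifP.
apply/seteqP; split=> w /=.
  rewrite /marked /letter => h; exists (phase w) => //; split => //.
  by case: ifP h => //= _; case: ifP.
by move=> [s _ [<-]]; rewrite /marked /letter; case: ifP => //= _; case: ifP.
Qed.

HB.instance Definition _ := isMeasurableFun.Build _ _ _ _ marked measurable_marked.

Local Notation word_prob := (word_prob (R := R) marked).
Local Notation emits := (emits marked).
Local Notation G := (always_sync M K).

Lemma emits_markedP x w : emits x w <->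
  forall i, (i < size x)%N -> marked (time_shift i w) = nth false x i.
Proof. exact: emitsP. Qed.

Lemma phase_down w j r : G w -> (r <= phase (time_shift j w))%N ->
  phase (time_shift (j + r) w) = (phase (time_shift j w) - r)%N.
Proof. by move=> Gw; exact: (@trajectory_down M K M_gt0 (fun j => phase (time_shift j w))
  (fun j => w (j, 0, 0)%N) (phase_trajectory M_gt0 Gw)). Qed.

Lemma phase_up w j i : G w -> phase (time_shift (j + i) w) = M -> (i <= K)%N ->
  phase (time_shift j w) = (M + i)%N.
Proof. by move=> Gw; exact: (@trajectory_up M K M_gt0 (fun j => phase (time_shift j w))
  (fun j => w (j, 0, 0)%N) (phase_trajectory M_gt0 Gw)). Qed.

Lemma phase_marker w j : G w ->
  (forall r, (r < M)%N -> marked (time_shift (j + r) w)) <->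
  phase (time_shift j w) = M.
Proof.
move=> Gw; exact: (@marker_phase M K m M_gt0 (fun j => phase (time_shift j w))
  (fun j => w (j, 0, 0)%N) (fun j => phi (time_shift j w)) (phase_trajectory M_gt0 Gw)).
Qed.

(** The letters d are those of the data next to a marker, whose phases are then
    M + size d, ..., M + 1. *)
Definition data_word (d : seq bool) : set field :=
  [set w | forall j, (j < size d)%N ->
    live M m (M + (size d - j)) && phi (time_shift j w) = nth false d j].

Lemma measurable_data_word d : measurable (data_word d).
Proof.
rewrite (_ : data_word d = \bigcap_(j in [set j | (j < size d)%N])
  (if live M m (M + (size d - j)) then time_shift j @^-1` (phi @^-1` [set nth false d j])
   else [set _ | nth false d j = false])).
  apply: bigcap_measurableType => j _; case: ifP => _.
    apply: measurable_time_shift; rewrite -[X in measurable X]setTI.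
    exact: measurable_funPT.
  case: (nth _ _ _) => /=.
    by rewrite (_ : [set _ | _] = set0)//; apply/seteqP; split.
  by rewrite (_ : [set _ | _] = setT)//; apply/seteqP; split.
apply/seteqP; split=> w /= h j /= jd; have := h j jd; case: ifP => _ //=.
Qed.

Lemma depends_on_data_word d : depends_on (before (size d)) (data_word d).
Proof.
move=> w w' ww' h j jd; rewrite -h//.
case e: (live _) => //=; apply: phi_memory => -[[t l] i]; rewrite /before /= => tm.
rewrite !time_shift_at; apply/esym/ww'; rewrite /before /=.
by move: e; rewrite /live => /andP[e _]; lia.
Qed.

(** The marker at the beginning of x fixes the phases of the letters d in front of
    it, and the data shown there depend on the coins at their own times only,
    hence not on x. *)
Lemma word_prob_data d x : (size d <= K)%N -> (M <= size x)%N ->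
  (forall r, (r < M)%N -> nth false x r) ->
  word_prob (d ++ x) = pr mu (data_word d) * word_prob x.
Proof.
move=> dK Mx ones.
have mE := measurable_emits marked x.
have mT := @measurable_time_shift (size d) _ mE.
have mD := measurable_data_word d.
rewrite -[word_prob x](pr_time_shift (size d) mE).
rewrite -(independence mD mT (@depends_on_data_word d)
  (@depends_on_time_shift _ (emits x))); last first.
  by move=> p; rewrite /before /from /=; lia.
apply: (eq_pr_on _ _ (measurable_always_sync M K) (pr_always_sync K M_gt0)).
- exact: measurable_emits.
- exact: measurableI.
have key w : G w -> emits x (time_shift (size d) w) ->
    (emits d w <-> data_word d w).
  move=> Gw /emitsP xw.
  have sd : phase (time_shift (size d) w) = M.
    apply/(phase_marker _ Gw) => r rM; rewrite -time_shiftD xw; last exact: leq_trans Mx.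
    exact: ones.
  have sj j : (j < size d)%N -> marked (time_shift j w) =
      live M m (M + (size d - j)) && phi (time_shift j w).
    move=> jd; rewrite /marked (phase_up (i := size d - j) Gw); last 2 first.
    - by rewrite subnKC// ltnW.
    - by lia.
    by rewrite /letter; case: (leqP (M + (size d - j)) M) => [|_]; [lia|rewrite andbF].
  rewrite emitsP; split=> h j jd; first by rewrite -sj// h.
  exact: etrans (sj j jd) (h j jd).
apply/seteqP; split=> w [h Gw]; split => //.
  by move/emits_cat: h => [h1 h2]; split => //; apply/key.
by case: h => h1 h2; apply/emits_cat; split => //; apply/key.
Qed.

Lemma word_prob_forced a x e :
  (forall w, G w -> emits x (time_shift 1 w) -> marked w = e) ->
  word_prob (a :: x) = (a == e)%:R * word_prob x.
Proof.
move=> h; have mE := measurable_emits marked x.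
rewrite -[word_prob x](pr_time_shift 1 mE).
case: (eqVneq a e) => [->|ae].
  rewrite mul1r.
  apply: (eq_pr_on _ _ (measurable_always_sync M K) (pr_always_sync K M_gt0)).
  - exact: measurable_emits.
  - exact: measurable_time_shift.
  apply/seteqP; split=> w [hw Gw]; split => //; first by case/emits_cons: hw.
  by apply/emits_cons; split => //; exact: h.
rewrite mul0r -(pr_set0 mu).
apply: (eq_pr_on _ _ (measurable_always_sync M K) (pr_always_sync K M_gt0)) => //.
- exact: measurable_emits.
rewrite set0I -subset0 => w [/emits_cons[aw xw] Gw].
by move: ae; rewrite -aw [X in X != _](h _ Gw xw) eqxx.
Qed.

Lemma word_prob_free a x :
  (forall w, G w -> emits x (time_shift 1 w) -> marked w = w (0, 0, 0)%N) ->
  word_prob (a :: x) = pr mu [set w : field | w (0, 0, 0)%N = a] * word_prob x.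
Proof.
move=> h; have mE := measurable_emits marked x.
have mA : measurable [set w : field | w (0, 0, 0)%N = a].
  have := measurable_cylinder [:: (0, 0, 0)%N] (fun=> a).
  congr (measurable _); apply/seteqP; split=> w /=; first by apply; rewrite mem_head.
  by move=> wa p; rewrite inE => /eqP ->.
have mT := @measurable_time_shift 1 _ mE.
rewrite -[word_prob x](pr_time_shift 1 mE).
have dA : depends_on (before 1) [set w : field | w (0, 0, 0)%N = a].
  by move=> w w' ww' /=; rewrite ww'.
rewrite -(independence mA mT dA (@depends_on_time_shift _ (emits x))); last first.
  by move=> p; rewrite /before /from /=; lia.
apply: (eq_pr_on _ _ (measurable_always_sync M K) (pr_always_sync K M_gt0)).
- exact: measurable_emits.
- exact: measurableI.
apply/seteqP; split=> w [hw Gw]; split => //.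
  by case/emits_cons: hw => wa xw; split => //=; rewrite -wa [RHS]h.
by case: hw => /= wa xw; apply/emits_cons; split => //; rewrite [LHS]h.
Qed.

(** N letters reveal the phase: either they contain a whole marker, or the phase
    is below M and zero exactly when the nearest letter is 0. In the data the next
    letter is governed by word_prob_data, in the idle phase by a new coin, and
    otherwise it is forced. *)
Lemma marked_markov : Defs.markov N (factor R marked).
Proof.
apply: markov_of_reversed => a v vN.
have [[i [iK ones]]|noM] := pselect (exists i, (i <= K)%N /\
    forall r, (r < M)%N -> nth false v (i + r)).
  have [iK'|Ki] := ltnP i K.
    exists (pr mu (data_word (a :: take i v))), (pr mu (data_word (take i v))),
      (fun u => word_prob (drop i v ++ u)) => u.
    have si : size (take i v) = i by rewrite size_takel// vN; lia.
    have Md : (M <= size (drop i v))%N by rewrite size_drop vN; lia.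
    have on r : (r < M)%N -> nth false (drop i v ++ u) r.
      by move=> rM; rewrite nth_cat (leq_trans rM Md) nth_drop ones.
    have Mdu : (M <= size (drop i v ++ u))%N by rewrite size_cat; lia.
    split; first by rewrite -word_prob_data//= ?si//= catA cat_take_drop.
    by rewrite -word_prob_data// ?si ?(ltnW iK')// catA cat_take_drop.
  have eK : i = K by apply/eqP; rewrite eqn_leq iK.
  exists ((a == false)%:R), 1, (fun u => word_prob (v ++ u)) => u.
  rewrite mul1r; split => //; apply: word_prob_forced => w Gw /emits_markedP vw.
  have s1 : phase (time_shift 1 w) = N.
    apply: phase_up => //; apply/(phase_marker _ Gw) => r rM.
    rewrite -addnA -time_shiftD vw ?size_cat ?vN; last by lia.
    by rewrite nth_cat vN ifT; [rewrite -eK ones|lia].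
  have := phase_trajectory M_gt0 Gw 0; rewrite time_shift0 s1 /marked => ->.
  by rewrite /cycle_step ltnn; case: eqP => [|//]; lia.
have v1 w u : G w -> emits (v ++ u) (time_shift 1 w) ->
    (phase (time_shift 1 w) < M)%N /\
    nth false v 0 = (0 < phase (time_shift 1 w))%N.
  move=> Gw /emits_markedP vw.
  have rd i : (i < N)%N -> marked (time_shift (1 + i) w) = nth false v i.
    by move=> iN; rewrite -time_shiftD vw ?nth_cat ?size_cat vN ?iN//; lia.
  have sM : (phase (time_shift 1 w) < M)%N.
    rewrite ltnNge; apply/negP => Ms; apply: noM.
    exists (phase (time_shift 1 w) - M)%N.
    have le := phase_le K M_gt0 (time_shift 1 w).
    split=> [|r rM]; first by lia.
    rewrite -rd; last by lia.
    rewrite addnA; move: r rM; apply/(phase_marker _ Gw).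
    by rewrite phase_down//; lia.
  have dead : live M m (phase (time_shift 1 w)) = false.
    by apply/negbTE; rewrite negb_and -leqNgt; apply/orP; left; lia.
  split => //; rewrite -rd; last by lia.
  by rewrite addn0 /marked /letter dead orbF (ltnW sM) andbT.
case e0 : (nth false v 0).
  exists ((a == true)%:R), 1, (fun u => word_prob (v ++ u)) => u.
  rewrite mul1r; split => //; apply: word_prob_forced => w Gw /(v1 _ _ Gw)[sM].
  rewrite e0 => /esym s0.
  have := phase_trajectory M_gt0 Gw 0; rewrite time_shift0 /marked => ->.
  by rewrite cycle_step_up ?/letter; lia.
exists (pr mu [set w : field | w (0, 0, 0)%N = a]), 1,
  (fun u => word_prob (v ++ u)) => u.
rewrite mul1r; split => //; apply: word_prob_free => w Gw /(v1 _ _ Gw)[sM].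
rewrite e0 => /esym /negbT; rewrite -eqn0Ngt => /eqP s0.
have := phase_trajectory M_gt0 Gw 0; rewrite time_shift0 s0 /marked => ->.
by rewrite /cycle_step /=; case: (w _); rewrite /letter /= ?M_gt0.
Qed.

End marked.

(** * Every coding of the coins is a B-process *)

Section factors_are_B.
Context {R : realType}.
Notation mu := (coin R).

Lemma pr_phase (M K s : nat) : (0 < M)%N -> (0 < s <= M + K)%N ->
  pr mu [set w | phase M K w = s] = pr mu [set w | phase M K w = 1%N].
Proof.
move=> M0; elim: s => [//|[//|s] IHs] sN.
by rewrite pr_phase_shift ?IHs//; lia.
Qed.

Lemma pr_phase_le (M K s : nat) : (0 < M)%N -> (0 < K)%N ->
  pr mu [set w | phase M K w = s] <= 2 / (M + K)%:R.
Proof.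
move=> M0 K0; set N := (M + K)%N.
set q := pr mu [set w | phase M K w = 1%N].
have N0 : 0 < N%:R :> R by rewrite ltr0n; lia.
have mP k : measurable [set w | phase M K w = k] by exact: measurable_phase.
have mQ n : measurable [set w | (0 < phase M K w <= n)%N].
  rewrite (_ : [set _ | _] = \bigcup_(k in [set k | (0 < k <= n)%N])
     [set w | phase M K w = k]); first exact: bigcup_measurable.
  apply/seteqP; split=> w /=; first by move=> h; exists (phase M K w).
  by move=> [k /= h ->].
have sumq n : (n <= N)%N -> pr mu [set w | (0 < phase M K w <= n)%N] = n%:R * q.
  elim: n => [|n IHn] nN.
    rewrite mul0r -(pr_set0 mu); congr (pr mu _).
    by apply/seteqP; split=> w //=; lia.
  rewrite (_ : [set _ | _] = [set w | (0 < phase M K w <= n)%N] `|`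
      [set w | phase M K w = n.+1]).
    rewrite prU//; last by rewrite -subset0 => w [/= h1 h2]; lia.
    rewrite IHn; last exact: ltnW.
    rewrite pr_phase -/q; [by rewrite -[n.+1]addn1 natrD mulrDl mul1r|by []|by rewrite nN].
  apply/seteqP; split=> w /= => [h|[h|->]]; [|by lia|by lia].
  by have [e|ne] := eqVneq (phase M K w) n.+1; [right|left; lia].
have qN : q <= N%:R^-1.
  rewrite -[leRHS]mul1r ler_pdivlMr// mulrC -sumq//; exact: pr_le1.
have q0 : 0 <= q := pr_ge0 _ _.
have [->|s0] := eqVneq s 0%N; first by rewrite pr_phase0 ?ler_wpM2l//.
have [sN|Ns] := leqP s N.
  rewrite (pr_phase M0) -/q; last by rewrite lt0n s0.
  by apply: le_trans qN _; rewrite ler_peMl ?invr_ge0 ?ltW//; lra.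
rewrite (_ : [set _ | _] = set0) ?pr_set0 ?divr_ge0//.
by apply/seteqP; split=> w //= e; have := phase_le K M0 w; rewrite e; lia.
Qed.

Lemma measurable_not_live (m M K : nat) : (0 < M)%N ->
  measurable [set w | ~~ live M m (phase M K w)].
Proof.
move=> M0; rewrite (_ : [set _ | _] = \bigcup_(i in [set i | ~~ live M m i])
    [set w | phase M K w = i]).
  by apply: bigcup_measurable => i _; exact: measurable_phase.
apply/seteqP; split=> w /=; first by move=> h; exists (phase M K w).
by move=> [i /= h ->].
Qed.

(** With data stretches of length M * M all phases are about equally likely, and
    only about 2 * M + m of the M + M * M phases are not live. *)
Lemma pr_not_live_le (m M : nat) : (m + 4 <= M)%N ->
  pr mu [set w | ~~ live M m (phase M (M * M) w)] <= 6 / M%:R.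
Proof.
move=> mM; have M0 : (0 < M)%N by lia.
have K0 : (0 < M * M)%N by rewrite muln_gt0 M0.
pose A i : set field := [set w | phase M (M * M) w = i].
pose B i : set field := [set w | phase M (M * M) w = (i * M)%N].
have mA i : measurable (A i) by exact: measurable_phase.
have mB i : measurable (B i) by exact: measurable_phase.
have mU (F : nat -> set field) k : (forall i, measurable (F i)) ->
    measurable [set w | exists2 i, (i < k)%N & F i w].
  move=> mF; rewrite (_ : [set _ | _] = \bigcup_(i in [set i | (i < k)%N]) F i).
    exact: bigcup_measurable.
  by apply/seteqP; split=> x /= [i ? ?]; exists i.
have le1 := pr_bigcup_ord_le mu (M + m + 2) mA.
have le2 := pr_bigcup_ord_le mu (M + 2) mB.
set r : R := 2 / (M + M * M)%:R.
have {}le1 : pr mu [set w | exists2 i, (i < M + m + 2)%N & A i w] <=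
    (M + m + 2)%:R * r.
  apply: le_trans le1 _; rewrite -[in leRHS](card_ord (M + m + 2)) mulr_natl -sumr_const.
  by apply: ler_sum => i _; exact: pr_phase_le.
have {}le2 : pr mu [set w | exists2 i, (i < M + 2)%N & B i w] <= (M + 2)%:R * r.
  apply: le_trans le2 _; rewrite -[in leRHS](card_ord (M + 2)) mulr_natl -sumr_const.
  by apply: ler_sum => i _; exact: pr_phase_le.
apply: (@le_trans _ _ ((M + m + 2)%:R * r + (M + 2)%:R * r)).
  apply: le_trans (lerD le1 le2).
  apply: le_trans (prU_le _ (mU _ _ mA) (mU _ _ mB)).
  apply: le_pr; [exact: measurable_not_live|by apply: measurableU; exact: mU|].
  move=> w /=; rewrite negb_and -leqNgt negbK => /orP[h|/dvdnP[i hi]].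
    by left; exists (phase M (M * M) w) => //; lia.
  right; exists i => //.
  have : (i * M <= M.+1 * M)%N by rewrite -hi mulSn; exact: phase_le.
  by rewrite leq_pmul2r//; lia.
rewrite -mulrDl -natrD /r mulrA ler_pdivrMr ?ltr0n ?addn_gt0 ?M0//.
rewrite mulrAC ler_pdivlMr ?ltr0n// -!natrM ler_nat; nia.
Qed.

Lemma measurable_neq (f g : field -> bool) : measurable_fun setT f ->
  measurable_fun setT g -> measurable [set w | f w != g w].
Proof.
move=> mf mg; rewrite (_ : [set _ | _] = disagree [set w | f w] [set w | g w]).
  by apply: measurable_disagree; exact/measurable_boolP.
by rewrite /disagree; apply/seteqP; split=> w /=; case: (f w); case: (g w) => //=;
  intuition.
Qed.

Lemma neq_trans (f g h : field -> bool) :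
  [set w | f w != h w] `<=` [set w | f w != g w] `|` [set w | g w != h w].
Proof.
move=> w /= fh; case: (eqVneq (f w) (g w)) => [<-|]; by [right|left].
Qed.

(** The marked coding shows phi at the live phases. *)
Lemma finite_memory_approx (phi : {mfun field >-> bool}) (m : nat) (e : R) :
  (forall w w' : field, (forall p, before m p -> w p = w' p) -> phi w = phi w') ->
  0 < e -> exists psi : {mfun field >-> bool},
    aperiodic_ergodic_markov (factor R psi) /\
    pr mu [set w | phi w != psi w] < e.
Proof.
move=> phi_m e0; pose M := (m + 4 + (Num.truncn (6 / e)).+1)%N.
have M0 : (0 < M)%N by rewrite /M; lia.
unshelve eexists (marked phi m M (M * M) : {mfun field >-> bool}).
  exact: M0.
split.
  split; [exact: factor_stationary|exact: factor_ergodic|].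
  exists (M + M * M)%N; split; [by rewrite addn_gt0 M0| |exact: factor_aperiodic].
  exact: marked_markov.
apply: (@le_lt_trans _ _ (6 / M%:R)).
  apply: le_trans (_ : _ <= pr mu [set w | ~~ live M m (phase M (M * M) w)]) _.
    apply: le_pr.
    - exact: measurable_neq.
    - exact: measurable_not_live.
    move=> w /=; apply: contra => lw; rewrite /marked /letter lw.
    have {lw} /andP[h _] := lw.
    have -> : (phase M (M * M) w <= M)%N = false.
      by apply/negbTE; rewrite -ltnNge; exact: leq_ltn_trans (leq_addr _ _) h.
    by rewrite andbF.
  by apply: pr_not_live_le; rewrite /M; lia.
have h6 : 6 / e < M%:R.
  by apply: lt_le_trans (truncnS_gt _) _; rewrite ler_nat leq_addl.
have M1 : 0 < M%:R :> R by rewrite ltr0n.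
by rewrite (ltr_pdivrMr _ _ M1) mulrC -(ltr_pdivrMr _ _ e0).
Qed.

(** A coding is close to one of finite memory, and this one is close to its marked
    version, which is Markov. *)
Theorem factor_B (phi : {mfun field >-> bool}) : B_process R (factor R phi).
Proof.
split=> [|eps eps0]; first exact: factor_stationary.
have mphi : measurable [set w | phi w] by exact/measurable_boolP.
have e20 : 0 < eps / 2 by rewrite divr_gt0.
have [m [B [mB dB phiB]]] := measurable_approximable mphi e20.
have mb : measurable_fun setT (fun w => `[< B w >]).
  apply/measurable_boolP; rewrite (_ : [set _ | _] = B)//.
  by apply/seteqP; split=> w /= /asboolP.
pose b : {mfun field >-> bool} :=
  HB.pack (fun w : field => `[< B w >]) (isMeasurableFun.Build _ _ _ _ _ mb).
have b_m (w w' : field) : (forall p, before m p -> w p = w' p) -> b w = b w'.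
  move=> h; apply/asboolP/asboolP; first exact: dB.
  by apply: dB => p /h.
have [psi [psiM bpsi]] := finite_memory_approx b_m e20.
exists (factor R psi); split => //.
apply: le_lt_trans (dbar_factor_le psi (fun E _ => erefl)) _.
have mneq (f g : {mfun field >-> bool}) : measurable [set w | f w != g w].
  exact: measurable_neq.
rewrite lte_fin; apply: (@le_lt_trans _ _
  (pr mu [set w | phi w != b w] + pr mu [set w | b w != psi w])).
  apply: le_trans (prU_le _ (mneq _ _) (mneq _ _)).
  apply: le_pr => //; first exact: measurableU.
  exact: neq_trans.
suff : pr mu [set w | phi w != b w] <= eps / 2 by lra.
apply/ltW/(le_lt_trans _ phiB); apply: le_pr => //.
  exact: measurable_disagree.
move=> w /=; rewrite /b /= /disagree /=.
by case: asboolP => Bw; case: (phi w) => //=; intuition.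
Qed.

End factors_are_B.

(** * Slowly changing modes *)

Section modes.
Context {R : realType}.
Notation mu := (coin R).
Implicit Types (l b n t : nat) (s : bool).

Definition level_in (L : set nat) : set site := [set p | L p.1.2].

Lemma depends_on_level_shift (L : set nat) n A : depends_on (level_in L) A ->
  depends_on (level_in L `&` from n) (time_shift n @^-1` A).
Proof.
move=> dA; apply: (@depends_onS (later n @` level_in L)).
  by move=> _ [p Lp <-]; split => //; rewrite /from /later /= leq_addr.
exact: depends_on_relabel.
Qed.

Lemma pr_cylinder_gt0 (q : seq site) (f : field) :
  0 < pr mu [set w | forall p, p \in q -> w p = f p].
Proof.
rewrite (_ : [set _ | _] = [set w | forall p, p \in undup q -> w p = f p]).
  by rewrite /pr coin_cylinder ?undup_uniq//= exprn_gt0// invr_gt0.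
by apply/seteqP; split=> w /= h p pq; apply: h; move: pq; rewrite mem_undup.
Qed.

(** An event of probability 2^-b that is decided at time 0 and level l. *)
Definition heads l b (w : field) : bool := all (fun i => w (0, l, i)%N) (iota 0 b).

Lemma heads_all_heads l b :
  [set w | heads l b w] = all_heads [seq (0, l, i)%N | i <- iota 0 b].
Proof.
apply/seteqP; split=> w /=; first by move/allP => h _ /mapP[i ib ->]; exact: h.
by move=> h; apply/allP => i ib; apply: h; exact: map_f.
Qed.

Lemma measurable_heads l b : measurable [set w | heads l b w].
Proof. by rewrite heads_all_heads; exact: measurable_all_heads. Qed.

Lemma measurable_heads_at l b k : measurable (time_shift k @^-1` [set w | heads l b w]).
Proof. by apply: measurable_time_shift; exact: measurable_heads. Qed.

Lemma pr_heads l b : pr mu [set w | heads l b w] = 2^-1 ^+ b.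
Proof.
rewrite heads_all_heads /pr coin_all_heads ?size_map ?size_iota//.
by rewrite map_inj_uniq ?iota_uniq// => i j [].
Qed.

Lemma eq_heads l b (w w' : field) :
  (forall i, w (0, l, i)%N = w' (0, l, i)%N) -> heads l b w = heads l b w'.
Proof. by move=> h; apply: eq_all => i; exact: h. Qed.

Definition first_at l b n (w : field) : Prop :=
  heads l b (time_shift n w) /\
  forall k, (k < n)%N -> ~~ heads l b (time_shift k w).

Lemma first_at_unique l b n n' w : first_at l b n w -> first_at l b n' w -> n = n'.
Proof.
move=> [h1 h2] [h1' h2']; case: (ltngtP n n') => // [/h2'|/h2].
  by rewrite h1.
by rewrite h1'.
Qed.

(** The mode at time 0 is the coin at level l.+1 at the first time from 0 on when
    level l shows b heads; so it is constant between such times, and they occur at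
    rate 2^-b. *)
Definition mode_is l b s : set field :=
  [set w | exists n, first_at l b n w /\ w (n, l.+1, 0%N) = s].

Definition mode l b (w : field) : bool := `[< mode_is l b true w >].

Lemma modeE l b s w : mode_is l b s w -> mode l b w = s.
Proof.
case: s => [h|[n [h1 h2]]]; apply/asboolP => //.
by move=> [n' [h1' h2']]; rewrite -(first_at_unique h1 h1') h2 in h2'.
Qed.

Lemma measurable_first_at l b n : measurable [set w | first_at l b n w].
Proof.
rewrite (_ : [set _ | _] = time_shift n @^-1` [set w | heads l b w] `&`
  \bigcap_(k in [set k | (k < n)%N]) ~` (time_shift k @^-1` [set w | heads l b w])).
  apply: measurableI; first exact: measurable_heads_at.
  apply: bigcap_measurableType => k _; apply: measurableC.
  exact: measurable_heads_at.
apply/seteqP; split=> w /= [h1 h2]; split=> // k /=.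
  by move=> kn; apply/negP/h2.
by move=> kn; apply/negP; exact: h2.
Qed.

Lemma measurable_site_eq p s : measurable [set w : field | w p = s].
Proof.
have := measurable_cylinder [:: p] (fun=> s).
congr (measurable _); apply/seteqP; split=> w /=; first by apply; rewrite mem_head.
by move=> wa q; rewrite inE => /eqP ->.
Qed.

Lemma measurable_mode_is l b s : measurable (mode_is l b s).
Proof.
rewrite (_ : mode_is l b s = \bigcup_n ([set w | first_at l b n w] `&`
  [set w : field | w (n, l.+1, 0%N) = s])).
  apply: bigcupT_measurable => n; apply: measurableI.
    exact: measurable_first_at.
  exact: measurable_site_eq.
apply/seteqP; split=> w /=; first by move=> [n [h1 h2]]; exists n.
by move=> [n _ [h1 h2]]; exists n.
Qed.

Lemma depends_on_mode_is l b s :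
  depends_on (level_in [set k | k = l \/ k = l.+1]) (mode_is l b s).
Proof.
move=> w w' h [n [[h1 h2] h3]]; exists n.
have hh k : heads l b (time_shift k w) = heads l b (time_shift k w').
  by apply: eq_heads => i; rewrite !time_shift_at; apply: h; left.
split; last by rewrite -h3; apply/esym/h; right.
by split; [rewrite -hh|move=> k kn; rewrite -hh; exact: h2].
Qed.

Lemma mode_is_earlier l b s j n w : (j <= n)%N ->
  (forall k, (k < n)%N -> ~~ heads l b (time_shift k w)) ->
  mode_is l b s (time_shift n w) -> mode_is l b s (time_shift j w).
Proof.
move=> jn none [i [[h1 h2] h3]]; exists (n - j + i)%N.
have e : (j + (n - j + i) = n + i)%N by lia.
rewrite time_shift_at e -h3 time_shift_at; split=> //; split.
  by rewrite time_shiftD e -time_shiftD.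
move=> k ki; rewrite time_shiftD; have [jk|nk] := ltnP (j + k) n; first exact: none.
by rewrite -(subnKC nk) -time_shiftD; apply: h2; lia.
Qed.

Definition never l b : set field := [set w | forall n, ~~ heads l b (time_shift n w)].

Lemma measurable_never l b : measurable (never l b).
Proof.
rewrite (_ : never l b = \bigcap_n ~` (time_shift n @^-1` [set w | heads l b w])).
  apply: bigcapT_measurable => n; apply: measurableC.
  exact: measurable_heads_at.
by apply/seteqP; split=> w /= h n; [move=> _; apply/negP|apply/negP; exact: h].
Qed.

Lemma pr_never l b : pr mu (never l b) = 0.
Proof.
apply: (@pr_avoiding_null _ 1 [set w | heads l b w]).
- exact: measurable_heads.
- exact: measurable_never.
- by move=> w w' h /=; rewrite (@eq_heads _ _ w w')// => i; apply: h.
- by rewrite pr_heads exprn_gt0// invr_gt0.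
- by move=> w /(_ 0%N); rewrite time_shift0 => /negP.
- by move=> w h n; rewrite time_shiftD; exact: h.
Qed.

(** Flipping all the coins at level l.+1 exchanges the two modes. *)
Lemma pr_mode_is l b s : pr mu (mode_is l b s) = 2^-1.
Proof.
have mM s' : measurable (mode_is l b s') by exact: measurable_mode_is.
have sym : pr mu (mode_is l b true) = pr mu (mode_is l b false).
  pose h : field := fun p => p.1.2 == l.+1.
  rewrite /pr -(coin_flip h (mM true)); congr (fine (mu _)).
  have hf w k : heads l b (time_shift k (flip h w)) = heads l b (time_shift k w).
    apply: eq_heads => i; rewrite !time_shift_at /flip /h /=.
    by rewrite (ltn_eqF (ltnSn l)) addbF.
  have hff w n : flip h w (n, l.+1, 0)%N = ~~ w (n, l.+1, 0)%N.
    by rewrite /flip /h /= eqxx addbT.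
  apply/seteqP; split=> w /= [n [[h1 h2] h3]]; exists n;
    (split; first (split; [by rewrite ?hf// -hf|])).
  - by move=> k /h2; rewrite hf.
  - by move: h3; rewrite hff; case: (w _).
  - by move=> k /h2; rewrite hf.
  - by rewrite hff h3.
have : pr mu (mode_is l b true `|` mode_is l b false) = 1.
  rewrite (_ : _ `|` _ = ~` never l b).
    by rewrite prC ?pr_never ?subr0//; exact: measurable_never.
  apply/seteqP; split=> w /=.
    by case=> -[n [[h1 _] _]] /(_ n); rewrite h1.
  move=> nv; have ex : exists n, heads l b (time_shift n w).
    by apply/not_existsP => h; apply: nv => n; apply/negP/h.
  have fa : first_at l b (ex_minn ex) w.
    case: ex_minnP => n h1 h2; split=> // k kn; apply/negP => /h2.
    by rewrite leqNgt kn.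
  by case e : (w (ex_minn ex, l.+1, 0)%N); [left|right]; exists (ex_minn ex).
rewrite prU//; first by case: s; lra.
by rewrite -subset0 => w [/modeE e1 /modeE]; rewrite e1.
Qed.

End modes.

(** * Layered processes and their frozen versions *)

Section layered_processes.
Context {R : realType}.
Notation mu := (coin R).
Implicit Types (c : nat -> nat) (t n : nat) (s : bool).

(** Layer t uses three levels: 3 * t tells where the layer is visible, 3 * t + 1
    when its state changes, and 3 * t + 2 to what. Its changes and the visibility
    of the next layer share the scale c t.+1. *)
Definition rare c t (w : field) : bool := heads (3 * t) (c t) w.
Definition state_is c t s : set field := mode_is (3 * t).+1 (c t.+1) s.
Definition state c t (w : field) : bool := mode (3 * t).+1 (c t.+1) w.

(** Lower layers take precedence, so that adding layers changes only the sites
    where no lower layer is visible. *)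
Fixpoint show_layers c t (d : bool) (w : field) : bool :=
  if t is t'.+1 then
    show_layers c t' (if rare c t' w then state c t' w else d) w
  else d.

Definition frozen c t s (w : field) : bool := show_layers c t (rare c t w && s) w.

Definition limit_coding c (w : field) : bool :=
  `[< exists t, [/\ rare c t w, forall t', (t' < t)%N -> ~~ rare c t' w
       & state c t w] >].

Lemma show_layersP c t d w : show_layers c t d w <->
  (exists t', [/\ (t' < t)%N, rare c t' w,
     forall t'', (t'' < t')%N -> ~~ rare c t'' w & state c t' w]) \/
  ((forall t', (t' < t)%N -> ~~ rare c t' w) /\ d).
Proof.
elim: t d => [|t IHt] d /=.
  by split=> [dT|[[t' []]|[]]//]; right.
rewrite IHt; split.
  case=> [[t' [h1 h2 h3 h4]]|[h1]].
    by left; exists t'; split => //; exact: ltnW.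
  case: ifPn => [rt st|nrt dT]; first by left; exists t.
  by right; split => // t'; rewrite ltnS leq_eqVlt => /predU1P[->|/h1].
case=> [[t' [h1 h2 h3 h4]]|[h1 dT]].
  move: h1; rewrite ltnS leq_eqVlt => /predU1P[e|h1]; last by left; exists t'.
  by subst t'; right; split => //; rewrite h2.
right; split; first by move=> t' h; apply: h1; exact: ltnW.
by rewrite (negbTE (h1 t (ltnSn t))).
Qed.

Lemma limit_frozen c t s w : state_is c t s w ->
  (forall t', (t < t')%N -> ~~ rare c t' w) -> limit_coding c w = frozen c t s w.
Proof.
move=> sw high.
have -> : frozen c t s w = show_layers c t.+1 false w.
  by rewrite /frozen /= /state (modeE sw); case: (rare c t w).
apply/asboolP/idP => [[t' [h1 h2 h3]]|/show_layersP[[t' [h0 h1 h2 h3]]|[]//]].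
  apply/show_layersP; left; exists t'; split => //; rewrite ltnS leqNgt; apply/negP => /high.
  by rewrite h1.
by exists t'.
Qed.

Lemma eq_frozen c c' t s w : (forall i, (i <= t)%N -> c i = c' i) ->
  frozen c t s w = frozen c' t s w.
Proof.
move=> cc'; rewrite /frozen (_ : rare c t w = rare c' t w); last first.
  by rewrite /rare cc'.
move: (_ && _) => d; elim: {-2}t (leqnn t) d => [//|u IHu] ut d /=.
by rewrite /rare /state (cc' u (ltnW ut)) (cc' u.+1 ut); exact: IHu (ltnW ut) _.
Qed.

Lemma measurable_rare c t : measurable [set w | rare c t w].
Proof. exact: measurable_heads. Qed.

Lemma measurable_state c t : measurable [set w | state c t w].
Proof.
rewrite (_ : [set _ | _] = state_is c t true); first exact: measurable_mode_is.
by apply/seteqP; split=> w /= /asboolP.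
Qed.

Lemma measurable_show_layers c t (d : field -> bool) : measurable_fun setT d ->
  measurable_fun setT (fun w => show_layers c t (d w) w).
Proof.
elim: t d => [//|t IHt] d md; apply: IHt.
apply: measurable_fun_ifT => //; apply/measurable_boolP.
  exact: measurable_rare.
exact: measurable_state.
Qed.

Lemma measurable_frozen c t s : measurable_fun setT (frozen c t s).
Proof.
apply: measurable_show_layers; case: s.
  rewrite (_ : (fun _ => _) = rare c t); last by apply/funext => w; rewrite andbT.
  by apply/measurable_boolP; exact: measurable_rare.
rewrite (_ : (fun _ => _) = cst false); first exact: measurable_cst.
by apply/funext => w; rewrite andbF.
Qed.

HB.instance Definition _ c t s := isMeasurableFun.Build _ _ _ _
  (frozen c t s) (measurable_frozen c t s).

Lemma measurable_limit_coding c : measurable_fun setT (limit_coding c).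
Proof.
apply/measurable_boolP.
rewrite (_ : [set _ | _] = \bigcup_t ([set w | rare c t w] `&`
    (\bigcap_(t' in [set t' | (t' < t)%N]) ~` [set w | rare c t' w]) `&`
    [set w | state c t w])).
  apply: bigcupT_measurable => t; apply: measurableI; last exact: measurable_state.
  apply: measurableI; first exact: measurable_rare.
  apply: bigcap_measurableType => t' _; apply: measurableC; exact: measurable_rare.
apply/seteqP; split=> w /=.
  move/asboolP => [t [h1 h2 h3]]; exists t => //; split => //; split => //.
  by move=> t' /h2/negP.
move=> [t _ [[h1 h2] h3]]; apply/asboolP; exists t; split=> // t' h.
by apply/negP; exact: h2.
Qed.

HB.instance Definition _ c := isMeasurableFun.Build _ _ _ _
  (limit_coding c) (measurable_limit_coding c).

Lemma depends_on_frozen c t s (w w' : field) :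
  (forall p, level_in [set k | (k <= 3 * t)%N] p -> w p = w' p) ->
  frozen c t s w = frozen c t s w'.
Proof.
move=> ww'; have rE u : (u <= t)%N -> rare c u w = rare c u w'.
  by move=> ut; apply: eq_heads => i; apply: ww'; rewrite /level_in /=; lia.
rewrite /frozen (rE t)//; move: (_ && _) => d.
elim: {-2}t (leqnn t) d => [//|u IHu] ut d /=; rewrite (rE u (ltnW ut)).
have -> : state c u w = state c u w'; last exact: IHu (ltnW ut) _.
have half (v v' : field) : (forall p, level_in [set k | (k <= 3 * t)%N] p -> v p = v' p) ->
    state_is c u true v -> state_is c u true v'.
  move=> h; apply: depends_on_mode_is => p; rewrite /level_in /= => hp.
  by apply: h; rewrite /level_in /=; lia.
by apply/asboolP/asboolP; apply: half => // p /ww'.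
Qed.

Lemma depends_on_emits (psi : {mfun field >-> bool}) (L : set nat) x :
  (forall w w' : field, (forall p, level_in L p -> w p = w' p) -> psi w = psi w') ->
  depends_on (level_in L) (emits psi x).
Proof.
move=> dpsi w w' ww' /emitsP h; apply/emitsP => i ix; rewrite -h//.
by apply: dpsi => -[[a b] e] Lb; rewrite !time_shift_at ww'.
Qed.

(** Where layer t is the lowest visible layer, the two processes differ in one
    direction only, and elsewhere they coincide. *)
Lemma frozen_distinct c t : (forall i, (0 < c i)%N) ->
  ~ same_distribution (factor R (frozen c t true)) (factor R (frozen c t false)).
Proof.
move=> c0 /(_ _ (measurable_word_at 0 [:: true])); rewrite !factorE.
have wE s : factor_path (frozen c t s) @^-1` word_at 0 [:: true] =
    [set w | frozen c t s w].
  apply/seteqP; split=> w.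
    by move=> /(emitsP (frozen c t s)) /(_ 0%N isT) /=; rewrite time_shift0.
  by move=> h; apply/(emitsP (frozen c t s)) => -[|//] _ /=; rewrite time_shift0.
rewrite !wE; set A := [set w | _]; set B := [set w | _] => AB.
have mA : measurable A by apply/measurable_boolP; exact: measurable_frozen.
have mB : measurable B by apply/measurable_boolP; exact: measurable_frozen.
pose q : seq site := [seq (0, 3 * i, 0)%N | i <- iota 0 t] ++
  [seq (0, 3 * t, i)%N | i <- iota 0 (c t)].
pose f : field := fun p => p.1.2 == (3 * t)%N.
pose C : set field := [set w | forall p, p \in q -> w p = f p].
have mC : measurable C by exact: measurable_cylinder.
have rC w : C w -> rare c t w /\ forall t', (t' < t)%N -> ~~ rare c t' w.
  move=> Cw; split.
    apply/allP => i ib; rewrite Cw /f /= ?eqxx// mem_cat; apply/orP; right.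
    by apply/mapP; exists i.
  move=> t' t't; apply/allPn; exists 0%N; first by rewrite mem_iota add0n c0.
  rewrite Cw /f /=; first by rewrite eqn_pmul2l// ltn_eqF.
  by rewrite mem_cat; apply/orP; left; apply/mapP; exists t'; rewrite ?mem_iota.
have sub : B `|` C `<=` A.
  move=> w [|/rC[r1 r2]]; rewrite /A /= /frozen.
    rewrite /B /= /frozen andbF andbT => /show_layersP[h|[//]].
    by apply/show_layersP; left.
  by apply/show_layersP; right; rewrite r1.
have dis : B `&` C = set0.
  rewrite -subset0 => w [Bw /rC[r1 r2]]; move: Bw.
  rewrite /B /= /frozen andbF => /show_layersP[[t' [h1 h2 h3 h4]]|[]//].
  by move: (r2 t' h1); rewrite h2.
have := le_pr mu (measurableU _ _ mB mC) mA sub; rewrite prU// /pr AB.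
by have := pr_cylinder_gt0 (R := R) q f; rewrite /pr -/C; lra.
Qed.

Definition quiet l b n : set field :=
  [set w | forall j, (j < n)%N -> ~~ heads l b (time_shift j w)].

Definition active l b n : set field :=
  [set w | exists2 j, (j < n)%N & heads l b (time_shift j w)].

Lemma quietE l b n : quiet l b n = ~` active l b n.
Proof.
apply/seteqP; split=> w /=.
  by move=> h [j jn hj]; have := h j jn; rewrite hj.
by move=> h j jn; apply/negP => hj; apply: h; exists j.
Qed.

Lemma measurable_active l b n : measurable (active l b n).
Proof.
rewrite (_ : active l b n = \bigcup_(j in [set j | (j < n)%N])
  time_shift j @^-1` [set w | heads l b w]).
  by apply: bigcup_measurable => j _; exact: measurable_heads_at.
by apply/seteqP; split=> w /= [j ? ?]; exists j.
Qed.

Lemma pr_active_le l b n : pr mu (active l b n) <= n%:R * 2^-1 ^+ b.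
Proof.
apply: le_trans (pr_bigcup_ord_le mu n (fun j => measurable_heads_at l b j)) _.
rewrite -[X in _ <= X%:R * _](card_ord n) mulr_natl -sumr_const ler_sum// => j _.
rewrite pr_time_shift ?pr_heads//; exact: measurable_heads.
Qed.

Lemma depends_on_quiet l b n :
  depends_on (level_in [set l] `&` before n) (quiet l b n).
Proof.
move=> w w' ww' h j jn; rewrite -(@eq_heads l b (time_shift j w)); first exact: h.
move=> i; rewrite !time_shift_at addn0; apply: ww'; split => //.
Qed.

(** Three independent events, which are also independent of the frozen process,
    turn the limit process into the frozen one up to time n: layer t does not
    change its state (E2), its state at time n is s (E3), and no higher layer is
    visible (E4). Each has probability at least 1/2. *)
Lemma frozen_le_limit c t n s x : (n <= c t.+1 - 2)%N ->
  (2 <= c t.+1)%N -> (forall i, (c i < c i.+1)%N) -> size x = n ->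
  8^-1 * word_prob (R := R) (frozen c t s) x <= word_prob (R := R) (limit_coding c) x.
Proof.
move=> nc c2 cS xn.
have cD i : (c t.+1 + i <= c (t.+1 + i)%N)%N.
  by elim: i => [|i IHi]; rewrite ?addn0// !addnS; exact: leq_ltn_trans IHi (cS _).
pose E1 := emits (frozen c t s) x.
pose E2 := quiet (3 * t).+1 (c t.+1) n.
pose E3 := time_shift n @^-1` state_is c t s.
pose H i := active (3 * (t.+1 + i)) (c (t.+1 + i)%N) n.
pose E4 : set field := ~` \bigcup_i H i.
have mE1 : measurable E1 by exact: measurable_emits.
have mE2 : measurable E2.
  by rewrite /E2 quietE; apply: measurableC; exact: measurable_active.
have mE3 : measurable E3 by apply: measurable_time_shift; exact: measurable_mode_is.
have mH i : measurable (H i) by exact: measurable_active.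
have mU : measurable (\bigcup_i H i) by exact: bigcupT_measurable.
have mE4 : measurable E4 by exact: measurableC.
have half2 k : 0 <= (2^-1 : R) ^+ k by rewrite exprn_ge0// invr_ge0.
(* Layer t.+1 + i is visible before time n with probability at most 2^-(i+2). *)
have small i : n%:R * (2^-1 : R) ^+ (c (t.+1 + i)%N) <= 2^-1 ^+ (i + 2).
  have nb : (n + (i + 2) <= c (t.+1 + i)%N)%N by have := cD i; lia.
  apply: (@le_trans _ _ (n%:R * 2^-1 ^+ (n + (i + 2)))).
    rewrite ler_wpM2l// ler_wiXn2l// ?invr_ge0//; lra.
  rewrite exprD mulrA ler_piMl// exprVn ler_pdivrMr ?exprn_gt0// mul1r.
  by rewrite -natrX ler_nat; apply/ltnW/ltn_expl.
have p2 : 2^-1 <= pr mu E2.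
  rewrite /E2 quietE prC; last exact: measurable_active.
  have := pr_active_le (3 * t).+1 (c t.+1) n; have := small 0%N.
  by rewrite addn0 add0n expr2; lra.
have p3 : pr mu E3 = 2^-1.
  rewrite pr_time_shift; [exact: pr_mode_is|exact: measurable_mode_is].
have p4 : 2^-1 <= pr mu E4.
  rewrite prC// -[leLHS](_ : 1 - 2^-1 = _); last by lra.
  rewrite lerD2l lerN2; apply: pr_bigcup_le => // k.
  apply: (@le_trans _ _ (\sum_(i < k) 2^-1 ^+ (i + 2))).
    by apply: ler_sum => i _; exact: le_trans (pr_active_le _ _ _) (small i).
  suff -> : \sum_(i < k) (2^-1 : R) ^+ (i + 2) = 2^-1 - 2^-1 ^+ k.+1.
    by have := half2 k.+1; lra.
  elim: k => [|k IHk]; first by rewrite big_ord0 expr1 subrr.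
  by rewrite big_ord_recr/= IHk addn2 !exprS; lra.
have d1 : depends_on (level_in [set k | (k <= 3 * t)%N]) E1.
  by apply: depends_on_emits; exact: depends_on_frozen.
have d2 : depends_on (level_in [set (3 * t).+1] `&` before n) E2.
  exact: depends_on_quiet.
have d3 : depends_on (level_in [set k | k = (3 * t).+1 \/ k = (3 * t).+2] `&` from n) E3.
  by apply: depends_on_level_shift; exact: depends_on_mode_is.
have d4 : depends_on (level_in [set k | (3 * t.+1 <= k)%N]) E4.
  apply: depends_onC => w w' ww' [i _ [j jn hj]]; exists i => //; exists j => //.
  rewrite -(@eq_heads _ _ (time_shift j w))// => e; rewrite !time_shift_at.
  by apply: ww'; rewrite /level_in /=; lia.
have i23 : pr mu (E2 `&` E3) = pr mu E2 * pr mu E3.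
  by apply: (independence mE2 mE3 d2 d3) => p; rewrite /before /from /=; lia.
have m23 : measurable (E2 `&` E3) by exact: measurableI.
have d23 : depends_on (level_in [set k | k = (3 * t).+1 \/ k = (3 * t).+2]) (E2 `&` E3).
  apply: depends_onI.
    by apply: depends_onS d2 => p [h _]; rewrite /level_in /=; left.
  by apply: depends_onS d3 => p [h _].
have i234 : pr mu ((E2 `&` E3) `&` E4) = pr mu (E2 `&` E3) * pr mu E4.
  by apply: (independence m23 mE4 d23 d4) => p; rewrite /level_in /=; lia.
have m234 : measurable ((E2 `&` E3) `&` E4) by exact: measurableI.
have d234 : depends_on (level_in [set k | (3 * t < k)%N]) ((E2 `&` E3) `&` E4).
  apply: depends_onI.
    by apply: depends_onS d23 => p; rewrite /level_in /=; lia.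
  by apply: depends_onS d4 => p; rewrite /level_in /=; lia.
have i1234 : pr mu (E1 `&` ((E2 `&` E3) `&` E4)) =
    pr mu E1 * pr mu ((E2 `&` E3) `&` E4).
  by apply: (independence mE1 m234 d1 d234) => p; rewrite /level_in /=; lia.
have sub : E1 `&` ((E2 `&` E3) `&` E4) `<=` emits (limit_coding c) x.
  move=> w [/emitsP h1 [[h2 h3] h4]]; apply/emitsP => j jx; rewrite -h1//.
  apply: limit_frozen.
    by apply: mode_is_earlier h3 => //; rewrite -xn ltnW.
  move=> t' tt'; apply/negP => rt; apply: h4; exists (t' - t.+1)%N => //.
  by rewrite /H subnKC//; exists j => //; rewrite -xn.
apply: le_trans (le_pr mu (measurableI _ _ mE1 m234) (measurable_emits _ x) sub).
rewrite i1234 i234 i23 p3 /word_prob -/E1 mulrC ler_wpM2l ?pr_ge0//.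
have := pr_ge0 mu E2; have := pr_ge0 mu E4; nra.
Qed.

End layered_processes.

(** * The failure of discrimination *)

Section discrimination.
Context {R : realType}.
Notation mu := (coin R).

Definition pair_words n (l : seq (n.-tuple bool * n.-tuple bool)) :
    set (path_space bool * path_space bool) :=
  [set xy | (prefix_of n xy.1, prefix_of n xy.2) \in l].

Lemma prefix_of_word n (u : n.-tuple bool) :
  [set x | prefix_of n x = u] = word_at 0 u.
Proof.
have e (x : path_space bool) : mkseq (fun i => x (0 + i)%N) (size u) = prefix_of n x.
  apply: (@eq_from_nth _ false); rewrite size_mkseq ?size_tuple// => i ni.
  rewrite nth_mkseq// add0n -[i]/(nat_of_ord (Ordinal ni)) -tnth_nth.
  by rewrite tnth_mktuple.
apply/seteqP; split=> x; rewrite /word_at /= e; first by move=> ->.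
exact: val_inj.
Qed.

Lemma pair_words_cons n u l : pair_words (u :: l) =
  (word_at 0 u.1 `*` word_at 0 u.2) `|` pair_words (n := n) l.
Proof.
rewrite -!prefix_of_word; apply/seteqP; split=> -[x y] /=.
  rewrite /pair_words /= inE => /predU1P[e|h]; last by right.
  by left; rewrite -e.
rewrite /pair_words /= inE => -[[/= -> ->]|->]; last by rewrite orbT.
by rewrite -surjective_pairing eqxx.
Qed.

Lemma measurable_pair_words n l : measurable (pair_words (n := n) l).
Proof.
elim: l => [|u l IHl]; first by rewrite (_ : pair_words _ = set0)//; apply/seteqP; split.
rewrite pair_words_cons; apply: measurableU => //.
by apply: measurableX; exact: measurable_word_at.
Qed.

Lemma pair_words_le n (l : seq (n.-tuple bool * n.-tuple bool))
    (P1 P2 Q : process R) (a : R) : 0 <= a -> uniq l ->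
  (forall u : n.-tuple bool, a * pr P1 (word_at 0 u) <= pr Q (word_at 0 u)) ->
  (forall u : n.-tuple bool, a * pr P2 (word_at 0 u) <= pr Q (word_at 0 u)) ->
  a * a * pr (P1 \x P2)%E (pair_words l) <= pr (Q \x Q)%E (pair_words l).
Proof.
move=> a0 + h1 h2; elim: l => [_|u l IHl /= /andP[ul us]].
  by rewrite (_ : pair_words _ = set0) ?pr_set0 ?mulr0//; apply/seteqP; split.
have mw m v : measurable (word_at m v) := measurable_word_at m v.
have mX : measurable (word_at 0 u.1 `*` word_at 0 u.2) by exact: measurableX.
have dis : (word_at 0 u.1 `*` word_at 0 u.2) `&` pair_words l = set0.
  rewrite -!prefix_of_word -subset0 => -[x y] [[/= e1 e2]].
  by rewrite /pair_words /= e1 e2 -surjective_pairing (negbTE ul).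
have prX (P P' : process R) : pr (P \x P')%E (word_at 0 u.1 `*` word_at 0 u.2) =
    pr P (word_at 0 u.1) * pr P' (word_at 0 u.2).
  transitivity (fine (P (word_at 0 u.1) * P' (word_at 0 u.2))%E).
    by congr fine; exact: product_measure1E.
  by rewrite fineM// fin_num_measure.
rewrite pair_words_cons !prU//; try exact: measurable_pair_words.
rewrite !prX mulrDr lerD ?IHl// mulrACA ler_pM ?mulr_ge0 ?pr_ge0//.
Qed.

Definition answered_one (D : discrimination_procedure) n :=
  [seq u <- enum {: n.-tuple bool * n.-tuple bool} | D n u.1 u.2].

Lemma expected_answerE D (P P' : process R) n :
  expected_answer D P P' n = (pr (P \x P')%E (pair_words (answered_one D n)))%:E.
Proof.
rewrite /expected_answer -prE; last exact: measurable_pair_words.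
rewrite -(expectation_indic _ (measurable_pair_words _)); congr expectation.
apply/funext => -[x y] /=; rewrite indicE; congr (_%:R); congr nat_of_bool.
have e : pair_words (answered_one D n) (x, y) = D n (prefix_of n x) (prefix_of n y).
  by rewrite /pair_words /answered_one /= mem_filter mem_enum andbT.
by apply/idP/idP => [h|/set_mem]; [apply/mem_set|]; rewrite e.
Qed.

(** The next scale depends on all previous ones through f, and exceeds f by 2 at
    least: over f steps a rate of 2^-c is then harmless, even summed over all
    later scales. *)
Lemma scale_sequence (f : seq nat -> nat) : exists c : nat -> nat,
  c 0%N = 1%N /\ forall t, c t.+1 = (c t + f (mkseq c t.+1) + 2)%N.
Proof.
pose h := fix h t := if t is t'.+1 then
  rcons (h t') (last 0%N (h t') + f (h t') + 2)%N else [:: 1%N].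
pose c t := last 0%N (h t).
have hE t : h t = mkseq c t.+1.
  elim: t => [//|t IHt]; rewrite mkseqS -IHt /=; congr rcons.
  by rewrite /c /= last_rcons.
exists c; split => // t; rewrite -hE.
by rewrite /c /= last_rcons.
Qed.

Lemma expected_answer_cvg (D : discrimination_procedure) (P P' : process R) (l : R) :
  expected_answer D P P' n @[n --> \oo] --> l%:E ->
  pr (P \x P')%E (pair_words (answered_one D n)) @[n --> \oo] --> l.
Proof.
move=> h; apply: (@fine_cvg _ _ _ _
  (fun n => (pr (P \x P')%E (pair_words (answered_one D n)))%:E)).
by under eq_fun do rewrite -expected_answerE.
Qed.

(** The list h holds the scales of finitely many layers, the last of which is
    frozen. The default 1 makes all scales positive. *)
Definition separation_time (D : discrimination_procedure) (h : seq nat) (n : nat) :=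
  2^-1 < pr (factor R (frozen (nth 1%N h) (size h).-1 true) \x
             factor R (frozen (nth 1%N h) (size h).-1 false))%E
         (pair_words (answered_one D n)).

Lemma separation_time_exists D h : asymptotically_correct D (B_process R) ->
  all (ltn 0%N) h -> exists n, (size h <= n)%N /\ separation_time D h n.
Proof.
move=> Dok h0; have pos i : (0 < nth 1%N h i)%N.
  by have [ih|hi] := ltnP i (size h); [exact: (all_nthP 1%N h0)|rewrite nth_default].
have [_] := Dok _ _ (factor_B (frozen (nth 1%N h) (size h).-1 true))
  (factor_B (frozen (nth 1%N h) (size h).-1 false)).
move=> /(_ (@frozen_distinct R _ _ pos)) /expected_answer_cvg.
have lt1 : 2^-1 < 1 :> R by lra.
move=> /cvgr_gt /(_ _ lt1) [N _ hN]; exists (maxn (size h) N).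
by split; [exact: leq_maxl|apply: hN; exact: leq_maxr].
Qed.

End discrimination.

Theorem theorem1 (R : realType) :
  ~ exists D : discrimination_procedure, asymptotically_correct D (B_process R).
Proof.
move=> [D Dok].
have /choice[f fP] : forall h, exists n, all (ltn 0%N) h ->
    (size h <= n)%N /\ separation_time (R := R) D h n.
  move=> h; have [h0|_] := boolP (all (ltn 0%N) h); last by exists 0%N.
  by have [n nP] := separation_time_exists Dok h0; exists n.
have [c [c0 cS]] := scale_sequence f.
have pos i : (0 < c i)%N by case: i => [|i]; rewrite ?c0 ?cS//; lia.
have incr i : (c i < c i.+1)%N by rewrite cS; lia.
pose Q : process R := factor R (limit_coding c).
have [+ _] := Dok Q Q (factor_B _) (factor_B _).
move=> /(_ (fun E _ => erefl)) /expected_answer_cvg.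
have gt0 : 0 < 128^-1 :> R by lra.
move=> /cvgr_lt /(_ _ gt0) [t _ small].
have [tn sep] : (t < f (mkseq c t.+1))%N /\
    separation_time (R := R) D (mkseq c t.+1) (f (mkseq c t.+1)).
  have /fP : all (ltn 0%N) (mkseq c t.+1) by apply/allP => _ /mapP[i _ ->]; exact: pos.
  by rewrite size_mkseq.
set n := f _ in tn sep; set h := mkseq c t.+1 in n sep tn.
have dom s (u : n.-tuple bool) :
    8^-1 * pr (factor R (frozen (nth 1%N h) (size h).-1 s)) (word_at 0 u) <=
    pr Q (word_at 0 u).
  have -> : pr (factor R (frozen (nth 1%N h) (size h).-1 s)) (word_at 0 u) =
      word_prob (R := R) (frozen c t s) u.
    have e : factor_path (frozen (nth 1%N h) (size h).-1 s) =
        factor_path (frozen c t s).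
      apply/funext => w; apply/funext => i; rewrite /factor_path size_mkseq /=.
      by apply: eq_frozen => j jt; rewrite nth_mkseq.
    by rewrite /word_prob /emits -e.
  by apply: (@frozen_le_limit _ _ _ n) => //; rewrite ?size_tuple// cS -/h -/n; lia.
have a0 : 0 <= 8^-1 :> R by lra.
have us : uniq (answered_one D n) by rewrite filter_uniq// enum_uniq.
(* Samples are told apart with probability at least 1/8 * 1/8 * 1/2. *)
have num (p q : R) : 2^-1 < p -> 8^-1 * 8^-1 * p <= q -> q < 128^-1 -> False by lra.
exact: num sep (pair_words_le a0 us (dom true) (dom false)) (small n (ltnW tn)).
Qed.
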